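(* Let $\mathcal{C}$ be any concept class with probabilistic representation dimension $d=\mathrm{PRDim}(\mathcal{C})$ and VC dimension $d_{\mathrm{VC}}$. Then, for any sufficiently small $\alpha,\varepsilon>0$ and all $m\in\mathbb{N}$, \[ n_m^{\mathrm{agn}(\mathcal{C};\alpha)}(\varepsilon,\delta=0)\le\tilde{O}\left(\frac{d}{\varepsilon}+\frac{d}{\alpha\varepsilon\sqrt{m}}+\frac{d}{\alpha^2 m}\right) \] and \[ n_m^{\mathrm{agn}(\mathcal{C};\alpha)}(\varepsilon,\delta=0)\ge\tilde{\Omega}\left(\frac{d}{\varepsilon}+\frac{d_{\mathrm{VC}}}{\alpha\varepsilon\sqrt{m}}+\frac{d_{\mathrm{VC}}}{\alpha^2 m}\right). \]
   Context: User-level DP: there are $n$ users each holding $m$ examples from a domain $\mathcal{Z}$; two inputs in $\mathcal{Z}^{nm}$ are user-level neighbors if they differ only in one user's $m$ examples; an algorithm with finite output set is $(\varepsilon,\delta)$-user-level DP if $\Pr[\mathbf{A}(\mathbf{x})\in S]\le e^\varepsilon\Pr[\mathbf{A}(\mathbf{x}')\in S]+\delta$ for all neighbors and all output sets $S$. For a task with correct-answer sets $\Psi(\mathcal{D})$, $n_m(\varepsilon,\delta)$ is the smallest $n$ such that some $(\varepsilon,\delta)$-user-level DP algorithm, given $nm$ i.i.d. samples from $\mathcal{D}$ grouped into $n$ users, outputs an element of $\Psi(\mathcal{D})$ with probability at least $2/3$ for every valid $\mathcal{D}$. Here $\mathcal{Z}=\mathcal{X}\times\{0,1\}$, $\mathcal{C}\subseteq\{0,1\}^{\mathcal{X}}$,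 $\mathrm{Err}_{\mathcal{D}}(c)=\Pr_{(x,y)\sim\mathcal{D}}[c(x)\ne y]$. In the agnostic task $\mathrm{agn}(\mathcal{C};\alpha)$ every distribution $\mathcal{D}$ on $\mathcal{Z}$ is valid and the correct outputs are $c:\mathcal{X}\to\{0,1\}$ with $\mathrm{Err}_{\mathcal{D}}(c)\le\min_{c'\in\mathcal{C}}\mathrm{Err}_{\mathcal{D}}(c')+\alpha$. A distribution $\mathcal{P}$ over finite sets $\mathcal{H}$ of functions $\mathcal{X}\to\{0,1\}$ is an $(\alpha,\beta)$-probabilistic representation of $\mathcal{C}$ if for every $c\in\mathcal{C}$ and every distribution $\mathcal{D}_{\mathcal{X}}$ on $\mathcal{X}$, with probability $1-\beta$ over $\mathcal{H}\sim\mathcal{P}$ there is $h\in\mathcal{H}$ with $\Pr_{x\sim\mathcal{D}_{\mathcal{X}}}[c(x)\ne h(x)]\le\alpha$; $\mathrm{size}(\mathcal{P})=\max_{\mathcal{H}\in\mathrm{supp}(\mathcal{P})}\log|\mathcal{H}|$; $\mathrm{PRDim}(\mathcal{C})$ is the minimum of $\mathrm{size}(\mathcal{P})$ over $(1/4,1/4)$-probabilistic representations. $\tilde{O},\tilde{\Omega}$ hide polylogarithmic factors. *)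

(* Defs.v *)
From HB Require Import structures.
From mathcomp Require Import all_boot all_order all_algebra finmap.
From mathcomp Require Import all_classical all_reals all_analysis.

Set Implicit Arguments.
Unset Strict Implicit.
Unset Printing Implicit Defensive.
Import Order.TTheory GRing.Theory Num.Theory.

Local Open Scope classical_set_scope.
Local Open Scope ring_scope.
Local Open Scope ereal_scope.

Section iid.
Context (disp : measure_display) (T : measurableType disp) (R : realType).

Definition tcons (n : nat) (z : T * n.-tuple T) : n.+1.-tuple T :=
  [tuple of z.1 :: z.2].

Lemma measurable_tcons (n : nat) : measurable_fun [set: T * n.-tuple T] (@tcons n).
Proof. exact: (measurable_cons measurable_fst measurable_snd). Qed.

HB.instance Definition _ (n : nat) :=
  isMeasurableFun.Build _ _ _ _ (@tcons n) (@measurable_tcons n).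

(* The n-fold product measure, i.e. the law of n i.i.d. samples from D. *)
Fixpoint iid (D : probability T R) (n : nat) : probability (n.-tuple T) R :=
  match n with
  | 0 => dirac [tuple]
  | n'.+1 => distribution (D \x iid D n') (@tcons n')
  end.

End iid.

Section user_level_DP.
Context (disp : measure_display) (Z : measurableType disp) (R : realType)
  (O : choiceType).

(* Entry i of a dataset is the m-tuple of examples of user i. *)
Definition dataset (n m : nat) := n.-tuple (m.-tuple Z).

Definition user_neighbors (n m : nat) (x x' : dataset n m) : Prop :=
  exists i : 'I_n, forall j : 'I_n, j != i -> tnth x j = tnth x' j.

(* A randomized algorithm with finite output set: alg_prob x o is the
   probability of the output o on input x.  Measurability in x makes
   probabilities over random inputs meaningful. *)
Record algorithm (n m : nat) := Algorithm {
  alg_outputs : {fset O} ;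
  alg_prob : dataset n m -> O -> R ;
  alg_prob_ge0 : forall x o, (0 <= alg_prob x o)%R ;
  alg_prob_supp : forall x o, o \notin alg_outputs -> alg_prob x o = 0%R ;
  alg_prob_sum1 : forall x, (\sum_(o <- alg_outputs) alg_prob x o)%R = 1%R ;
  alg_prob_measurable : forall o, measurable_fun [set: dataset n m] (alg_prob ^~ o)
}.

Definition alg_in (n m : nat) (A : algorithm n m) (x : dataset n m) (S : set O) : R :=
  (\sum_(o <- alg_outputs A | o \in S) alg_prob A x o)%R.

Definition user_level_DP (n m : nat) (eps delta : R) (A : algorithm n m) : Prop :=
  forall (x x' : dataset n m) (S : set O), user_neighbors x x' ->
    (alg_in A x S <= expR eps * alg_in A x' S + delta)%R.

Record task := Task {
  task_valid : set (probability Z R) ;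
  task_correct : probability Z R -> set O
}.

Definition solves (n m : nat) (T : task) (A : algorithm n m) : Prop :=
  forall D : probability Z R, task_valid T D ->
    (2 / 3)%:E <= \int[iid (iid D m) n]_x (alg_in A x (task_correct T D))%:E.

(* n_m^T(eps, delta); equal to +oo if no number of users suffices. *)
Definition user_complexity (T : task) (m : nat) (eps delta : R) : \bar R :=
  ereal_inf [set n%:R%:E | n in [set n : nat |
    exists A : algorithm n m, user_level_DP eps delta A /\ solves T A]].

End user_level_DP.

Section learning.
Context (disp : measure_display) (X : measurableType disp) (R : realType).

Definition hypothesis := {mfun X >-> bool}.

Definition Err (D : probability (X * bool)%type R) (c : hypothesis) : \bar R :=
  D [set z | c z.1 != z.2].

Definition agn (C : set hypothesis) (alpha : R) :
    task (X * bool)%type R hypothesis :=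
  Task [set: probability (X * bool)%type R]
    (fun D => [set c | Err D c <= ereal_inf [set Err D c' | c' in C] + alpha%:E]).

Definition shatters (C : set hypothesis) (S : {fset X}) : Prop :=
  forall S' : set X, exists2 c, C c & forall x, x \in S -> (c x : Prop) <-> S' x.

Definition VCdim (C : set hypothesis) : \bar R :=
  ereal_sup [set #|` S|%:R%:E | S in shatters C].

(* A (discrete) distribution over finite sets of hypotheses, given by its
   probability mass function. *)
Definition is_pmf (P : {fset hypothesis} -> R) : Prop :=
  (forall H, (0 <= P H)%R) /\
  \esum_(H in [set: {fset hypothesis}]) (P H)%:E = 1.

Definition prob_representation (C : set hypothesis) (alpha beta : R)
    (P : {fset hypothesis} -> R) : Prop :=
  is_pmf P /\
  forall c, C c -> forall D : probability X R,
    (1 - beta)%:E <= \esum_(H in [set H : {fset hypothesis} |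
        exists2 h, h \in H & D [set x | c x != h x] <= alpha%:E]) (P H)%:E.

(* The convention ln 0 = 0 applies to H = fset0. *)
Definition prob_size (P : {fset hypothesis} -> R) : \bar R :=
  ereal_sup [set (ln (#|` H|%:R : R))%:E | H in [set H | (0 < P H)%R]].

Definition PRDim (C : set hypothesis) : \bar R :=
  ereal_inf [set prob_size P | P in prob_representation C (1 / 4) (1 / 4)].

End learning.

Arguments VCdim {disp X} R C.

(* Main.v *)
Require Import Defs.
From HB Require Import structures.
From mathcomp Require Import all_boot all_order all_algebra finmap.
From mathcomp Require Import all_classical all_reals all_analysis measurable_realfun.
From mathcomp Require Import ring lra zify.

Set Implicit Arguments.
Unset Strict Implicit.
Unset Printing Implicit Defensive.
Import Order.TTheory GRing.Theory Num.Theory.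

Local Open Scope classical_set_scope.
Local Open Scope ring_scope.

(** A probabilistic representation of size [d] amounts to a finite prior on
    hypotheses giving mass about [exp(-d)] to the approximations of each concept
    (pick a random [H], then a uniform element of [H]).

    Upper bound.  Boosting: the majority of [2k] independent draws from the prior
    is [(3/4)^k]-accurate with probability at least [exp(-O(d k))], so
    [M = exp(O(d log(1/alpha)))] such majorities contain a nearly optimal
    hypothesis.  To select among them, each user compares two candidates by the
    difference of their empirical errors, clipped to [[-B, B]] with
    [B = alpha/2 + O(log(1/alpha)/sqrt m)]; by subgaussian concentration clipping
    biases the comparison by at most [alpha/16].  An exponential mechanism built on
    the soft maximum of the summed comparisons has sensitivity [2B], and a single
    exponential moment bounds its failure probability together with the sampling error.

    Lower bound.  Group privacy turns the output law on any fixed dataset into a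
    prior of mass [exp(-eps n)/2], whence [d <= eps n + O(1)].  On a shattered set of
    size [k], let the labels agree with a sign vector [u] with probability
    [(1 + 32 alpha)/2].  The algorithm must land in a Hamming ball around [u], and such balls
    cover only a fraction [(3/5)^k] of the cube on average.  Passing from the biased
    to the unbiased law costs a factor [1 + sqrt(chi2) (exp(eps) - 1)] per user by
    privacy, or a chi-square term over all [n m] samples without it; averaging over
    [u] gives both remaining terms. *)

(** * Expectations of bounded measurable functions *)

Section expectation.
Context (d : measure_display) (T : measurableType d) (R : realType).
Implicit Types (P : probability T R) (f g : T -> R).

(** Bounded measurable functions are integrable for every probability and closed under the
    operations used below, so expectations can be computed in [R] rather than in the extended
    reals. *)
Definition bmf f := measurable_fun setT f /\ exists M : R, forall x, `|f x| <= M.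

Definition Ex P f : R := (\int[P]_x f x)%R.

Lemma bmf_integrable P f : bmf f -> P.-integrable setT (EFin \o f).
Proof.
move=> [mf [M fM]]; apply: measurable_bounded_integrable => //.
  by rewrite (le_lt_trans (probability_le1 P measurableT))// ltry.
exists M; split; first exact: num_real.
by move=> y My x _; apply: le_trans (fM x) (ltW My).
Qed.

Lemma EFin_Ex P f : bmf f -> (\int[P]_x (f x)%:E)%E = (Ex P f)%:E.
Proof.
move=> bf; rewrite /Ex /Rintegral fineK//.
exact: (integrable_fin_num measurableT (bmf_integrable P bf)).
Qed.

Lemma bmf_cst (c : R) : bmf (fun=> c).
Proof. by split; [exact: measurable_cst | exists `|c|]. Qed.

Lemma bmfD f g : bmf f -> bmf g -> bmf (fun x => f x + g x).
Proof.
move=> [mf [M fM]] [mg [N gN]]; split; first exact: measurable_funD.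
by exists (M + N) => x; rewrite (le_trans (ler_normD _ _))// lerD.
Qed.

Lemma bmfM f g : bmf f -> bmf g -> bmf (fun x => f x * g x).
Proof.
move=> [mf [M fM]] [mg [N gN]]; split; first exact: measurable_funM.
by exists (M * N) => x; rewrite normrM ler_pM.
Qed.

Lemma bmfZ (c : R) f : bmf f -> bmf (fun x => c * f x).
Proof. by move=> bf; apply: bmfM => //; exact: bmf_cst. Qed.

Lemma bmfN f : bmf f -> bmf (fun x => - f x).
Proof.
move=> bf; rewrite (_ : (fun x => - f x) = (fun x => -1 * f x)); first exact: bmfZ.
by apply/funext => x; rewrite mulN1r.
Qed.

Lemma bmfB f g : bmf f -> bmf g -> bmf (fun x => f x - g x).
Proof. by move=> bf bg; apply: bmfD => //; exact: bmfN. Qed.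

Lemma bmf_sum (I : Type) (s : seq I) (h : I -> T -> R) :
  (forall i, bmf (h i)) -> bmf (fun x => \sum_(i <- s) h i x).
Proof.
move=> bh; elim: s => [|i s IH].
  by under eq_fun do rewrite big_nil; exact: bmf_cst.
by under eq_fun do rewrite big_cons; exact: bmfD.
Qed.

Lemma bmf_prod (I : Type) (s : seq I) (h : I -> T -> R) :
  (forall i, bmf (h i)) -> bmf (fun x => \prod_(i <- s) h i x).
Proof.
move=> bh; elim: s => [|i s IH].
  by under eq_fun do rewrite big_nil; exact: bmf_cst.
by under eq_fun do rewrite big_cons; exact: bmfM.
Qed.

Lemma bmf_expR f : bmf f -> bmf (fun x => expR (f x)).
Proof.
move=> [mf [M fM]]; split; first exact: measurableT_comp.
exists (expR M) => x; rewrite ger0_norm ?expR_ge0// ler_expR.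
exact: le_trans (ler_norm _) (fM x).
Qed.

Lemma Ex_cst P (c : R) : Ex P (fun=> c) = c.
Proof.
rewrite /Ex Rintegral_cst// (_ : fine _ = 1) ?mulr1//.
transitivity (fine (1%E : \bar R)) => //; congr fine; exact: probability_setT.
Qed.

Lemma ExD P f g : bmf f -> bmf g -> Ex P (fun x => f x + g x) = Ex P f + Ex P g.
Proof. by move=> bf bg; apply: RintegralD => //; exact: bmf_integrable. Qed.

Lemma ExZ P (c : R) f : bmf f -> Ex P (fun x => c * f x) = c * Ex P f.
Proof. by move=> bf; apply: RintegralZl => //; exact: bmf_integrable. Qed.

Lemma ExB P f g : bmf f -> bmf g -> Ex P (fun x => f x - g x) = Ex P f - Ex P g.
Proof. by move=> bf bg; apply: RintegralB => //; exact: bmf_integrable. Qed.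

Lemma Ex_sum P (I : Type) (s : seq I) (h : I -> T -> R) :
  (forall i, bmf (h i)) ->
  Ex P (fun x => \sum_(i <- s) h i x) = \sum_(i <- s) Ex P (h i).
Proof.
move=> bh; elim: s => [|i s IH].
  by under eq_fun do rewrite big_nil; rewrite big_nil Ex_cst.
under eq_fun do rewrite big_cons; rewrite big_cons -IH ExD//.
exact: bmf_sum.
Qed.

Lemma le_Ex P f g : bmf f -> bmf g -> (forall x, f x <= g x) -> Ex P f <= Ex P g.
Proof. by move=> bf bg fg; apply: le_Rintegral => //; exact: bmf_integrable. Qed.

Lemma Ex_le_cst P f (c : R) : bmf f -> (forall x, f x <= c) -> Ex P f <= c.
Proof. by move=> bf fc; rewrite -(Ex_cst P c); apply: le_Ex => //; exact: bmf_cst. Qed.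

Lemma Ex_ge_cst P f (c : R) : bmf f -> (forall x, c <= f x) -> c <= Ex P f.
Proof. by move=> bf fc; rewrite -(Ex_cst P c); apply: le_Ex => //; exact: bmf_cst. Qed.

Lemma bmf_bool (b : T -> bool) : measurable_fun setT b -> bmf (fun x => (b x)%:R).
Proof.
move=> mb; split.
  exact: (@measurableT_comp _ _ _ _ _ _ (fun b : bool => b%:R : R)).
by exists 1 => x; case: (b x); rewrite ?normr1 ?normr0.
Qed.

Lemma Ex_bool P (b : T -> bool) : measurable_fun setT b ->
  (Ex P (fun x => (b x)%:R))%:E = P [set x | b x].
Proof.
move=> mb; rewrite -EFin_Ex; last exact: bmf_bool.
have mA : measurable [set x | b x].
  by rewrite -[X in measurable X]setTI; apply: (mb measurableT [set true]).
rewrite -[in RHS](setIT [set x | b x]) -(integral_indic P measurableT mA).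
apply: eq_integral => x _; congr (_%:E); rewrite indicE; congr (_%:R).
by congr nat_of_bool; apply/idP/idP => [bx|/set_mem//]; exact: mem_set.
Qed.

End expectation.

Lemma bmf_comp (R : realType) (d : measure_display) (T : measurableType d)
    (d' : measure_display) (T' : measurableType d') (phi : T' -> T)
    (f : T -> R) : measurable_fun setT phi -> bmf f -> bmf (fun x => f (phi x)).
Proof.
move=> mphi [mf [M fM]]; split; first exact: measurableT_comp.
by exists M => x.
Qed.

(** * Iterated expectations over i.i.d. samples *)

Section iid_expectation.
Context (d : measure_display) (T : measurableType d) (R : realType).
Implicit Types (D : probability T R).

Lemma bmf_tcons n (f : n.+1.-tuple T -> R) (x : T) :
  bmf f -> bmf (fun t : n.-tuple T => f [tuple of x :: t]).
Proof.
move=> bf; apply: (bmf_comp (phi := fun t : n.-tuple T => [tuple of x :: t])) bf.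
exact: measurable_cons.
Qed.

Lemma bmf_ge0_Ex (d' : measure_display) (T' : measurableType d')
    (P : probability T' R) (D : probability T R) (f : T * T' -> R) :
  bmf f -> (forall z, 0 <= f z) ->
  bmf (fun x => Ex P (fun y => f (x, y))) /\
  (\int[(D \x P)%E]_z (f z)%:E)%E = (Ex D (fun x => Ex P (fun y => f (x, y))))%:E.
Proof.
move=> bf f0; have [mf [M fM]] := bf.
have mf' : measurable_fun setT (EFin \o f) by exact/measurable_EFinP.
have f0' z : (0 <= (EFin \o f) z)%E by rewrite lee_fin.
have bfx x : bmf (fun y => f (x, y)).
  by split; [exact: measurableT_comp | exists M => y].
have FE x : fubini_F P (EFin \o f) x = (Ex P (fun y => f (x, y)))%:E.
  by rewrite /fubini_F -EFin_Ex.
have bF : bmf (fun x => Ex P (fun y => f (x, y))).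
  split.
    apply/measurable_EFinP.
    rewrite (_ : _ \o _ = fubini_F P (EFin \o f)); first exact: measurable_fun_fubini_tonelli_F.
    by apply/funext => x; rewrite FE.
  exists M => x; rewrite ger0_norm.
    by apply: Ex_le_cst => // y; exact: le_trans (ler_norm _) (fM _).
  exact: Ex_ge_cst.
split=> //; rewrite -EFin_Ex//.
rewrite (fubini_tonelli1 (EFin \o f))//.
by apply: eq_integral => x _; rewrite FE.
Qed.

Lemma iid_Ex_ge0 D n (f : n.+1.-tuple T -> R) : bmf f -> (forall t, 0 <= f t) ->
  bmf (fun x => Ex (iid D n) (fun t => f [tuple of x :: t])) /\
  Ex (iid D n.+1) f = Ex D (fun x => Ex (iid D n) (fun t => f [tuple of x :: t])).
Proof.
move=> bf f0.
have bg : bmf (fun z : T * n.-tuple T => f (tcons z)).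
  by apply: (bmf_comp (phi := @tcons _ _ n)) bf; exact: measurable_tcons.
have [bF EF] := bmf_ge0_Ex (iid D n) D bg (fun z => f0 _).
split=> //; apply: EFin_inj; rewrite -EFin_Ex// -EF /=.
rewrite ge0_integral_distribution//.
by apply/measurable_EFinP; case: bf.
Qed.

Lemma iid_Ex D n (f : n.+1.-tuple T -> R) : bmf f ->
  bmf (fun x => Ex (iid D n) (fun t => f [tuple of x :: t])) /\
  Ex (iid D n.+1) f = Ex D (fun x => Ex (iid D n) (fun t => f [tuple of x :: t])).
Proof.
move=> bf; have [_ [M fM]] := bf.
(* Shifting by the bound [M] makes the integrand nonnegative, so the Tonelli form applies; the shift
   is removed at the end. *)
have bM : bmf (fun t => f t + M) by apply: bmfD => //; exact: bmf_cst.
have [|b1 e1] := iid_Ex_ge0 D bM.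
  by move=> t; have := fM t; rewrite ler_norml => /andP[+ _]; lra.
have EE x : Ex (iid D n) (fun t => f [tuple of x :: t]) =
    Ex (iid D n) (fun t => f [tuple of x :: t] + M) - M.
  rewrite ExD ?Ex_cst ?addrK//; first exact: bmf_tcons.
  exact: bmf_cst.
have b2 : bmf (fun x => Ex (iid D n) (fun t => f [tuple of x :: t])).
  by under eq_fun do rewrite EE; apply: bmfB => //; exact: bmf_cst.
split=> //; have e2 := e1; rewrite (ExD (iid D n.+1) bf (bmf_cst _ _)) Ex_cst in e2.
under eq_fun do rewrite EE.
rewrite ExB//; last exact: bmf_cst.
by rewrite -e2 Ex_cst addrK.
Qed.

Lemma iid_Ex0 D (f : 0.-tuple T -> R) : bmf f -> Ex (iid D 0) f = f [tuple].
Proof.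
move=> bf; apply: EFin_inj; rewrite -EFin_Ex//= integral_dirac//.
  by rewrite diracT mul1e.
by apply/measurable_EFinP; case: bf.
Qed.

Lemma bmf_tnth n (f : T -> R) (i : 'I_n) : bmf f -> bmf (fun t : n.-tuple T => f (tnth t i)).
Proof. by move=> bf; apply: bmf_comp bf; exact: measurable_tnth. Qed.

Lemma bmf_tuple_sum n (f : T -> R) : bmf f ->
  bmf (fun t : n.-tuple T => \sum_(x <- t) f x).
Proof.
by move=> bf; under eq_fun do rewrite big_tuple; apply: bmf_sum => i; exact: bmf_tnth.
Qed.

Lemma bmf_tuple_prod n (f : T -> R) : bmf f ->
  bmf (fun t : n.-tuple T => \prod_(x <- t) f x).
Proof.
by move=> bf; under eq_fun do rewrite big_tuple; apply: bmf_prod => i; exact: bmf_tnth.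
Qed.

Lemma iid_Ex_prod D n (f : T -> R) : bmf f ->
  Ex (iid D n) (fun t => \prod_(x <- t) f x) = Ex D f ^+ n.
Proof.
move=> bf; elim: n => [|n IH].
  by rewrite iid_Ex0 ?big_nil ?expr0//; exact: bmf_tuple_prod.
have [_ ->] := iid_Ex D (bmf_tuple_prod n.+1 bf).
under eq_fun => x.
  under eq_fun do rewrite big_cons.
  rewrite ExZ; last exact: bmf_tuple_prod.
  rewrite IH mulrC; over.
by rewrite ExZ// exprSr.
Qed.

Lemma iid_Ex_sum D n (f : T -> R) : bmf f ->
  Ex (iid D n) (fun t => \sum_(x <- t) f x) = n%:R * Ex D f.
Proof.
move=> bf; elim: n => [|n IH].
  by rewrite iid_Ex0 ?big_nil ?mul0r//; exact: bmf_tuple_sum.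
have [_ ->] := iid_Ex D (bmf_tuple_sum n.+1 bf).
under eq_fun => x.
  under eq_fun do rewrite big_cons.
  rewrite ExD; last 2 first.
  - exact: bmf_cst.
  - exact: bmf_tuple_sum.
  rewrite IH Ex_cst; over.
rewrite ExD//; last exact: bmf_cst.
by rewrite Ex_cst -natr1 mulrDl mul1r addrC.
Qed.

End iid_expectation.

(** * Finitely supported laws and change of measure *)

Section tuple_weight.
Context (R : realType) (I : finType).
Implicit Types (p q : I -> R).

Definition tw p n (t : n.-tuple I) : R := \prod_(i <- t) p i.

Lemma sum_tuple_cons n (F : n.+1.-tuple I -> R) :
  \sum_t F t = \sum_i \sum_(t : n.-tuple I) F [tuple of i :: t].
Proof.
rewrite pair_big /=.
rewrite (reindex (fun z : I * n.-tuple I => [tuple of z.1 :: z.2]))//=.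
exists (fun t : n.+1.-tuple I => (thead t, [tuple of behead t])) => [[i t] _|t _] /=.
  by congr pair; apply: val_inj.
by rewrite -tuple_eta.
Qed.

Lemma sum_tuple0 (F : 0.-tuple I -> R) : \sum_t F t = F [tuple].
Proof.
rewrite (bigD1 [tuple])//= big1 ?addr0// => t.
by rewrite (tuple0 t) => /eqP; case; exact: val_inj.
Qed.

Lemma tw0 p (t : 0.-tuple I) : tw p t = 1.
Proof. by rewrite /tw tuple0 big_nil. Qed.

Lemma tw_cons p n i (t : n.-tuple I) : tw p [tuple of i :: t] = p i * tw p t.
Proof. by rewrite /tw big_cons. Qed.

Lemma tw_ge0 p n (t : n.-tuple I) : (forall i, 0 <= p i) -> 0 <= tw p t.
Proof. by move=> p0; apply: prodr_ge0. Qed.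

Lemma tw_gt0 p n (t : n.-tuple I) : (forall i, 0 < p i) -> 0 < tw p t.
Proof. by move=> p0; apply: prodr_gt0. Qed.

Lemma sum_tw p n : \sum_(t : n.-tuple I) tw p t = (\sum_i p i) ^+ n.
Proof.
elim: n => [|n IH]; first by rewrite sum_tuple0 tw0.
rewrite sum_tuple_cons exprS mulr_suml; apply: eq_bigr => i _.
by rewrite -IH mulr_sumr; apply: eq_bigr => t _; rewrite tw_cons.
Qed.

(** For probability weights, the sum of [p^2/q] is one plus the chi-square divergence. It is
    multiplicative over independent coordinates. *)
Lemma tw_div_sum p q n :
  \sum_(t : n.-tuple I) tw p t ^+ 2 / tw q t = (\sum_i p i ^+ 2 / q i) ^+ n.
Proof.
rewrite -sum_tw; apply: eq_bigr => t _.
by rewrite /tw -prodrXl -prodf_div.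
Qed.

End tuple_weight.

Section finite_law.
Context (d : measure_display) (T : measurableType d) (R : realType).
Implicit Types (D : probability T R).

(** The law is described by its expectations, so integrals become finite sums even when points [g i]
    coincide or singletons are not measurable. *)
Definition fin_law D (I : finType) (p : I -> R) (g : I -> T) :=
  forall f, bmf f -> Ex D f = \sum_i p i * f (g i).

Lemma normalized_measure (mu : {measure set T -> \bar R}) (z : R) :
  0 < z -> mu setT = z%:E ->
  exists P : probability T R, forall f : T -> R,
    measurable_fun setT f -> (forall x, 0 <= f x) ->
    (\int[P]_x (f x)%:E = z^-1%:E * \int[mu]_x (f x)%:E)%E.
Proof.
move=> z0 muz; exists (mnormalize mu (dirac point)) => f mf f0.
have zi0 : 0 <= z^-1 by rewrite invr_ge0 ltW.
rewrite [LHS](eq_measure_integral (mscale (NngNum zi0) mu)).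
  rewrite ge0_integral_mscale//; first exact/measurable_EFinP.
  by move=> x _; rewrite lee_fin.
(* Normalization falls back to a Dirac mass when the total mass is zero or infinite; here the mass
   [z] is positive and finite. *)
move=> A mA _; transitivity (if (z%:E == 0%E) || (z%:E == +oo%E) then \d_point A
  else (mu A * (fine z%:E)^-1%:E)%E); first by rewrite -muz /= /mnormalize; case: ifP.
by rewrite eqe gt_eqF//= muleC.
Qed.

Lemma fin_law_ge0 D (I : finType) (p : I -> R) (g : I -> T) :
  \sum_i p i = 1 ->
  (forall f, bmf f -> (forall x, 0 <= f x) -> Ex D f = \sum_i p i * f (g i)) ->
  fin_law D p g.
Proof.
move=> p1 H f bf; have [_ [M fM]] := bf.
have bM : bmf (fun x => f x + M) by apply: bmfD => //; exact: bmf_cst.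
have := H _ bM; rewrite (ExD D bf (bmf_cst _ _)) Ex_cst => E.
apply: (addIr M); rewrite E.
  rewrite -[in RHS](mul1r M) -p1 mulr_suml -big_split/=.
  by apply: eq_bigr => i _; rewrite mulrDr.
by move=> t; have := fM t; rewrite ler_norml => /andP[+ _]; lra.
Qed.

(** The measure is the weighted sum of Dirac masses at the [g i], indexed by positions in the
    enumeration of [I]; its total mass is already one. *)
Lemma fin_law_exists (I : finType) (p : I -> R) (g : I -> T) :
  (forall i, 0 <= p i) -> \sum_i p i = 1 -> exists D, fin_law D p g.
Proof.
move=> p0 p1.
have [i0] : inhabited I.
  apply: contrapT => noI; move: p1; rewrite big1; first by move/eqP; rewrite eq_sym oner_eq0.
  by move=> i; case: noI; constructor.
pose nu k := mscale (NngNum (p0 (nth i0 (enum I) k))) (\d_(g (nth i0 (enum I) k))).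
pose mu := msum nu (size (enum I)).
have int_mu (f : T -> R) : measurable_fun setT f -> (forall x, 0 <= f x) ->
    (\int[mu]_x (f x)%:E = (\sum_i p i * f (g i))%:E)%E.
  move=> mf f0.
  have mf' : measurable_fun setT (EFin \o f) by exact/measurable_EFinP.
  rewrite ge0_integral_measure_sum//=; last by move=> x _; rewrite lee_fin.
  rewrite -(big_enum _ _ _ (fun i => p i * f (g i))) /= (big_nth i0) big_mkord -sumEFin.
  apply: eq_bigr => k _; rewrite ge0_integral_mscale//=; last by move=> x _; rewrite lee_fin.
  by rewrite integral_dirac// diracT mul1e.
have muT : mu setT = 1%:E.
  have E := int_mu (fun=> 1) (measurable_cst _) (fun=> ler01).
  transitivity (\int[mu]_x (1 : R)%:E)%E; first by rewrite integral_cst// mul1e.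
  rewrite E; congr (_%:E).
  by rewrite -[RHS]p1; apply: eq_bigr => i _; rewrite mulr1.
have [D HD] := normalized_measure ltr01 muT.
exists D; apply: fin_law_ge0 => // f bf f0; apply: EFin_inj.
by rewrite -EFin_Ex// HD ?int_mu ?invr1 ?mul1e//; case: bf.
Qed.

End finite_law.

Lemma fin_law_iid (d : measure_display) (T : measurableType d) (R : realType)
    (D : probability T R) (I : finType) (p : I -> R) (g : I -> T) n :
  fin_law D p g -> fin_law (iid D n) (@tw R I p n) (fun t => map_tuple g t).
Proof.
move=> HD; elim: n => [|n IH] f bf.
  rewrite iid_Ex0// sum_tuple0 tw0 mul1r; congr f; exact: val_inj.
have [b ->] := iid_Ex D bf.
rewrite HD// sum_tuple_cons; apply: eq_bigr => i _.
rewrite IH; last exact: bmf_tcons.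
rewrite mulr_sumr; apply: eq_bigr => t _; rewrite tw_cons mulrA; congr (_ * f _).
exact: val_inj.
Qed.

(** * Change of measure for functions with bounded ratios *)

Section change_of_measure.
Context (R : realType).

(* Centering [f] at its [nu]-mean and applying Cauchy-Schwarz. *)
Lemma chi2_ratio_step (J : finType) (mu nu f : J -> R) (eps s : R) :
  (forall j, 0 < nu j) -> \sum_j nu j = 1 -> \sum_j mu j = 1 ->
  0 < eps -> 0 < s -> \sum_j mu j ^+ 2 / nu j - 1 <= s ^+ 2 ->
  (forall j, 0 <= f j) -> (forall i j, f i <= expR eps * f j) ->
  \sum_j mu j * f j <= (1 + s * (expR eps - 1)) * \sum_j nu j * f j.
Proof.
move=> nu0 nu1 mu1 eps0 s0 chi f0 fr; set m := \sum_j nu j * f j.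
have e1 : 1 < expR eps by rewrite expR_gt1.
have up i : f i <= expR eps * m.
  rewrite -[leLHS]mul1r -nu1 mulr_suml mulr_sumr; apply: ler_sum => j _.
  by rewrite mulrCA ler_wpM2l// ltW.
have dn i : m <= expR eps * f i.
  rewrite -[leRHS]mul1r -nu1 mulr_suml; apply: ler_sum => j _.
  by rewrite ler_wpM2l// ltW.
have m0 : 0 <= m by apply: sumr_ge0 => j _; rewrite mulr_ge0// ltW.
have [m_eq0|mN0] := eqVneq m 0.
  rewrite m_eq0 mulr0 big1// => j _.
  have : f j <= 0 by have := up j; rewrite m_eq0 mulr0.
  by move=> fj; rewrite (@le_anti _ _ (f j) 0) ?mulr0// f0 fj.
have mp : 0 < m by rewrite lt_neqAle eq_sym mN0.
have [w wE] : {w | w = (expR eps - 1) * m} by eexists.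
have w0 : 0 < w by rewrite wE mulr_gt0// subr_gt0.
(* The ratio condition confines every value of [f] to within a factor [expR eps] of the mean [m],
   hence to within [w] of it. *)
have fw j : (f j - m) ^+ 2 <= w ^+ 2.
  rewrite -[leLHS]real_normK ?num_real// ler_pXn2r ?nnegrE ?normr_ge0 ?(ltW w0)//.
  rewrite ler_norml; apply/andP; split.
    have := dn j; rewrite wE; have := up j; have := f0 j; nra.
  by have := up j; rewrite wE; lra.
have E1 : \sum_j mu j * f j - m = \sum_j (mu j - nu j) * (f j - m).
  under [RHS]eq_bigr do rewrite mulrBr mulrBl.
  rewrite !sumrB -mulr_suml sumrB nu1 mu1 subrr mul0r subr0.
  by [].
have E2 : \sum_j (mu j - nu j) ^+ 2 / nu j = \sum_j mu j ^+ 2 / nu j - 1.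
  transitivity (\sum_j (mu j ^+ 2 / nu j - 2 * mu j + nu j)).
    by apply: eq_bigr => j _; field; rewrite gt_eqF.
  by rewrite big_split sumrB/= -mulr_sumr nu1 mu1; lra.
(* A weighted form of AM-GM replaces Cauchy-Schwarz. The weights are balanced so that after
   summation each of the two terms contributes at most [s * w / 2]. *)
have amgm j : (mu j - nu j) * (f j - m) <=
    w / (2 * s) * ((mu j - nu j) ^+ 2 / nu j) + s / (2 * w) * (nu j * w ^+ 2).
  have n0 := nu0 j.
  apply: (@le_trans _ _ (w / (2 * s) * ((mu j - nu j) ^+ 2 / nu j)
     + s / (2 * w) * (nu j * (f j - m) ^+ 2))); last first.
    rewrite lerD2l; apply: ler_wpM2l; first by apply: divr_ge0; [exact: ltW | apply: mulr_ge0 => //; exact: ltW].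
    by apply: ler_wpM2l => //; exact: ltW.
  rewrite -subr_ge0.
  rewrite (_ : _ - _ = (w * (mu j - nu j) - s * nu j * (f j - m)) ^+ 2 / (2 * s * w * nu j)).
    by rewrite divr_ge0 ?sqr_ge0// !mulr_ge0// ltW.
  by field; rewrite !gt_eqF.
have S : \sum_j mu j * f j - m <= s * w.
  rewrite E1 (le_trans (ler_sum _ (fun j _ => amgm j)))//.
  rewrite big_split/= -!mulr_sumr -mulr_suml nu1 E2 mul1r.
  rewrite (_ : s / (2 * w) * w ^+ 2 = w / (2 * s) * s ^+ 2); last by field; rewrite !gt_eqF.
  rewrite (_ : s * w = w / (2 * s) * s ^+ 2 + w / (2 * s) * s ^+ 2); last by field; rewrite !gt_eqF.
  by rewrite lerD2r ler_pM2l// divr_gt0// mulr_gt0.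
by rewrite [leRHS](_ : _ = m + s * w); [lra | rewrite wE; ring].
Qed.

(** Average [f i <= c * f j] over independent [i] from [mu] and [j] from [nu]. *)
Lemma trivial_ratio_step (J : finType) (mu nu f : J -> R) (c : R) :
  (forall j, 0 <= nu j) -> \sum_j nu j = 1 -> (forall j, 0 <= mu j) -> \sum_j mu j = 1 ->
  (forall i j, f i <= c * f j) ->
  \sum_j mu j * f j <= c * \sum_j nu j * f j.
Proof.
move=> nu0 nu1 mu0 mu1 fr; rewrite -[leRHS]mul1r -mu1 mulr_suml; apply: ler_sum => i _.
rewrite ler_wpM2l// -[leLHS]mul1r -nu1 mulr_suml mulr_sumr; apply: ler_sum => j _.
by rewrite mulrCA ler_wpM2l.
Qed.

(** Coordinates are exchanged from [mu] to [nu] one at a time. With the others fixed, [F] is a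
    function of one coordinate with ratio at most [c], so each exchange costs a factor [rho]. *)
Lemma tensor_ratio (J : finType) (mu nu : J -> R) (c rho : R) n (F : n.-tuple J -> R) :
  (forall j, 0 <= nu j) -> (forall j, 0 <= mu j) -> 0 <= rho ->
  (forall f : J -> R, (forall j, 0 <= f j) -> (forall i j, f i <= c * f j) ->
     \sum_j mu j * f j <= rho * \sum_j nu j * f j) ->
  (forall t, 0 <= F t) ->
  (forall t t' : n.-tuple J, (exists i, forall j, j != i -> tnth t j = tnth t' j) ->
     F t <= c * F t') ->
  \sum_t tw mu t * F t <= rho ^+ n * \sum_t tw nu t * F t.
Proof.
move=> nu0 mu0 rho0 step; elim: n F => [|n IH] F F0 Fr.
  by rewrite !sum_tuple0 !tw0 expr0 !mul1r.
rewrite !sum_tuple_cons.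
apply: (@le_trans _ _ (\sum_i mu i * (rho ^+ n * \sum_(t : n.-tuple J) tw nu t * F [tuple of i :: t]))).
  apply: ler_sum => i _.
  under eq_bigr do rewrite tw_cons -mulrA.
  rewrite -mulr_sumr ler_wpM2l//; apply: IH => // t t' [k Hk].
  apply: Fr; exists (lift ord0 k) => j.
  by have [j' ->|->//] := unliftP ord0 j => jk; rewrite !tnthS; apply: Hk; apply: contraNneq jk => ->.
apply: (@le_trans _ _ (rho ^+ n * \sum_(t : n.-tuple J) tw nu t * \sum_i mu i * F [tuple of i :: t])).
  rewrite le_eqVlt; apply/orP; left; apply/eqP.
  under eq_bigr do rewrite mulrCA mulr_sumr.
  rewrite -mulr_sumr exchange_big/=; congr (_ * _).
  apply: eq_bigr => t _; rewrite mulr_sumr; apply: eq_bigr => i _.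
  by rewrite mulrCA.
rewrite exprSr -mulrA ler_wpM2l ?exprn_ge0//.
rewrite [leRHS](_ : _ = \sum_(t : n.-tuple J) tw nu t * (rho * \sum_i nu i * F [tuple of i :: t])).
  apply: ler_sum => t _; rewrite ler_wpM2l ?tw_ge0//; apply: step => // i j.
  apply: Fr; exists ord0 => k.
  by have [k' ->|->] := unliftP ord0 k; rewrite ?eqxx// !tnthS.
rewrite exchange_big/= mulr_sumr; apply: eq_bigr => t _.
rewrite !mulr_sumr; apply: eq_bigr => i _; rewrite tw_cons; ring.
Qed.

(** Chernoff argument: give [u] the weight [s] to the power of its distance from [h], with
    [s = r^32]. The total weight is [(1 + s)^k], and each point of the ball weighs at least [r^k].
    With [r = 9/10] and [s <= 1/20] the quotient [(1 + s) / r] is below [6/5]. *)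
Lemma hamming_ball (k : nat) (h : {ffun 'I_k -> bool}) :
  (#|[pred u : {ffun 'I_k -> bool} | (32 * #|[pred i | u i != h i]| <= k)%N]|%:R : R)
    <= (6 / 5) ^+ k.
Proof.
set B := [pred u | _].
pose r : R := 9 / 10; pose s : R := r ^+ 32.
have r0 : 0 < r by rewrite /r; lra.
have r1 : r <= 1 by rewrite /r; lra.
have s0 : 0 <= s by rewrite exprn_ge0// ltW.
have s1 : s <= 1 / 20.
  have e2 : r ^+ 2 = 81 / 100 by rewrite /r; field.
  have e4 : r ^+ 4 <= 66 / 100 by rewrite (exprM r 2 2) e2; lra.
  have e8 : r ^+ 8 <= 44 / 100.
    rewrite (exprM r 4 2); have : 0 <= r ^+ 4 by rewrite exprn_ge0// ltW.
    nra.
  have e16 : r ^+ 16 <= 2 / 10.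
    rewrite (exprM r 8 2); have : 0 <= r ^+ 8 by rewrite exprn_ge0// ltW.
    nra.
  rewrite /s (exprM r 16 2); have : 0 <= r ^+ 16 by rewrite exprn_ge0// ltW.
  nra.
have E : (1 + s) ^+ k = \sum_(u : {ffun 'I_k -> bool}) s ^+ #|[pred i | u i != h i]|.
  transitivity (\prod_(i < k) \sum_(b : bool) (if b != h i then s else 1)).
    rewrite (eq_bigr (fun=> 1 + s)) ?prodr_const ?card_ord//.
    move=> i _; rewrite (bigD1 (h i))//= eqxx/= (big_pred1 (~~ h i)).
      by case: (h i).
    by move=> b; case: b; case: (h i).
  rewrite bigA_distr_bigA/=; apply: eq_bigr => u _.
  rewrite -big_mkcond/= prodr_const; congr (_ ^+ _).
have : #|B|%:R * r ^+ k <= (1 + s) ^+ k.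
  rewrite E (bigID (mem B))/= -[leLHS]addr0 lerD ?sumr_ge0//; last first.
    by move=> u _; rewrite exprn_ge0.
  rewrite mulr_natl -sumr_const; apply: ler_sum => u; rewrite inE => uB.
  rewrite /s -exprM; apply: ler_wiXn2l => //; exact: ltW.
rewrite -ler_pdivlMr ?exprn_gt0// => /le_trans; apply.
rewrite -expr_div_n lerXn2r// ?nnegrE ?divr_ge0 ?addr_ge0 ?ler01 ?(ltW r0)//.
by rewrite ler_pdivrMr// /r; lra.
Qed.

End change_of_measure.

Lemma sum_const_mul (R : realType) (I : finType) (c : R) : \sum_(i : I) c = #|I|%:R * c.
Proof. by rewrite sumr_const mulr_natl. Qed.

Lemma sum_pmf_le (R : realType) (I : finType) (Q f : I -> R) (c : R) :
  (forall i, 0 <= Q i) -> \sum_i Q i = 1 -> (forall i, f i <= c) -> \sum_i Q i * f i <= c.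
Proof.
move=> Q0 Q1 fc; apply: (@le_trans _ _ (\sum_i Q i * c)).
  by apply: ler_sum => i _; apply: ler_wpM2l.
by rewrite -mulr_suml Q1 mul1r.
Qed.

Lemma pmf_event_le1 (R : realType) (I : finType) (p : I -> R) (E : pred I) :
  (forall i, 0 <= p i) -> \sum_i p i = 1 -> \sum_(i | E i) p i <= 1.
Proof.
by move=> p0 <-; rewrite [leRHS](bigID E)/= lerDl sumr_ge0.
Qed.

(** * Elementary bounds on the exponential *)

Section exponential_bounds.
Context (R : realType).
Implicit Types x : R.

Lemma onemx_expR_le1 x : (1 - x) * expR x <= 1.
Proof.
have e0 := expR_gt0 x.
by rewrite -ler_pdivlMr// mul1r -expRN; exact: expR_ge1Dx.
Qed.

Lemma expR_le1D2 x : 0 <= x -> x <= 1 / 2 -> expR x <= 1 + 2 * x.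
Proof.
move=> x0 x1; have e0 := expR_gt0 x.
have := onemx_expR_le1 x; nra.
Qed.

(** Squaring [(1 - x/2) exp(x/2) <= 1] bounds [exp(x)] by [(1 - x/2)^-2]. The comparison with the
    quadratic leaves the factor [1 - 3x + x^2], which is nonnegative for [x <= 1/3]. *)
Lemma expR_le1DxDx2 x : x <= 1 / 3 -> expR x <= 1 + x + x ^+ 2.
Proof.
move=> x1.
have e0 := expR_gt0 (x / 2).
have H := onemx_expR_le1 (x / 2).
have E : expR x = expR (x / 2) ^+ 2.
  by rewrite expr2 -expRD; congr expR; field.
have p : 0 < 1 - x / 2 by lra.
have H2 : (1 - x / 2) ^+ 2 * expR x <= 1.
  rewrite E -exprMn expr_le1// mulr_ge0// ltW//.
rewrite -(ler_pM2l (exprn_gt0 2 p)) (le_trans H2)// -subr_ge0.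
rewrite (_ : _ - 1 = x ^+ 2 / 4 * (1 - 3 * x + x ^+ 2)); last by field.
apply: mulr_ge0; first by rewrite divr_ge0// sqr_ge0.
have := sqr_ge0 x; nra.
Qed.

Lemma exprn_le_expR x n : -1 <= x -> (1 + x) ^+ n <= expR (x * n%:R).
Proof.
move=> x1; rewrite expRM_natr; apply: lerXn2r; rewrite ?nnegrE ?expR_ge0//; first lra.
exact: expR_ge1Dx.
Qed.

Lemma expR1_le4 : expR (1 : R) <= 4.
Proof.
have h0 : 0 <= 1 / 2 :> R by lra.
have H := expR_le1D2 h0 (lexx _).
have -> : expR (1 : R) = expR (1 / 2) ^+ 2 by rewrite -expRM_natr; congr expR; field.
by have := expR_gt0 (1 / 2 : R); nra.
Qed.

Lemma expR2_ge5 : 5 <= expR (2 : R).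
Proof.
have e1 := expR_ge1Dx (1 / 2 : R).
have -> : expR (2 : R) = expR (1 / 2) ^+ 4 by rewrite -expRM_natr; congr expR; field.
have : 9 / 4 <= expR (1 / 2 : R) ^+ 2 by nra.
by rewrite (exprM _ 2 2); set w := _ ^+ 2; nra.
Qed.

Lemma expR4_ge : 12 <= expR (4 : R).
Proof.
have e1 := expR_ge1Dx (1 : R).
rewrite -[4]mulr1 [4 * 1]mulrC expRM_natr (exprM _ 2 2).
have : 4 <= expR (1 : R) ^+ 2 by nra.
by set w := _ ^+ 2; nra.
Qed.

Lemma expRN4_le : expR (- (4 : R)) <= 1 / 12.
Proof.
rewrite expRN -[leRHS]invrK lef_pV2 ?posrE ?invr_gt0 ?expR_gt0//.
by have := expR4_ge; lra.
Qed.

Lemma nat_ceil (y : R) : 0 <= y -> exists2 k : nat, (0 < k)%N & y <= k%:R <= y + 1.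
Proof.
move=> y0; have /andP[ky yk] := truncn_itv y0.
by exists (Num.trunc y).+1 => //; rewrite (ltW yk) -natr1 lerD2r.
Qed.

Lemma ln_pos_le (x y : R) : 0 < x -> x <= y -> ln x <= ln y.
Proof. by move=> x0 xy; rewrite ler_ln ?posrE// (lt_le_trans x0). Qed.

End exponential_bounds.

Lemma measurable_neqb (d : measure_display) (T : measurableType d) (b1 b2 : T -> bool) :
  measurable_fun setT b1 -> measurable_fun setT b2 ->
  measurable_fun setT (fun x => b1 x != b2 x).
Proof.
move=> m1 m2.
rewrite (_ : (fun x => _) = (fun x => ~~ (nat_of_bool (b1 x) == nat_of_bool (b2 x)))); last first.
  by apply/funext => x; case: (b1 x); case: (b2 x).
apply: measurable_neg; apply: measurable_fun_eqn.
  exact: (@measurableT_comp _ _ _ _ _ _ nat_of_bool).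
exact: (@measurableT_comp _ _ _ _ _ _ nat_of_bool).
Qed.

(** * Errors and algorithms *)

Section error.
Context (disp : measure_display) (X : measurableType disp) (R : realType).
Implicit Types (c h : hypothesis X).

Definition miss h (z : X * bool) : R := (h z.1 != z.2)%:R.
Definition differ c h (x : X) : R := (c x != h x)%:R.
Definition err (D : probability (X * bool)%type R) h : R := Ex D (miss h).
Definition dis (D : probability X R) c h : R := Ex D (differ c h).

Lemma measurable_miss h : measurable_fun setT (fun z : X * bool => h z.1 != z.2).
Proof.
apply: measurable_neqb; last exact: measurable_snd.
by apply: measurableT_comp => //; exact: measurable_fst.
Qed.

Lemma bmf_miss h : bmf (miss h).
Proof. exact: (bmf_bool R (measurable_miss h)). Qed.

Lemma measurable_differ c h : measurable_fun setT (fun x : X => c x != h x).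
Proof. exact: measurable_neqb. Qed.

Lemma bmf_differ c h : bmf (differ c h).
Proof. exact: (bmf_bool R (measurable_differ c h)). Qed.

Lemma Err_err (D : probability (X * bool)%type R) h : Err D h = (err D h)%:E.
Proof. by rewrite /err (Ex_bool D (measurable_miss h)). Qed.

Lemma dis_prob (D : probability X R) c h : D [set x | c x != h x] = (dis D c h)%:E.
Proof. by rewrite /dis (Ex_bool D (measurable_differ c h)). Qed.

End error.

Section algorithms.
Context (disp : measure_display) (Z : measurableType disp) (R : realType)
  (O : choiceType) (n m : nat).
Implicit Types (A : algorithm Z R O n m) (S : set O).

Lemma alg_in_ge0 A x S : 0 <= alg_in A x S.
Proof. by apply: sumr_ge0 => o _; exact: alg_prob_ge0. Qed.

Lemma alg_in_le1 A x S : alg_in A x S <= 1.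
Proof.
rewrite -(alg_prob_sum1 A x) /alg_in [leRHS](bigID (fun o => o \in S))/= lerDl.
by apply: sumr_ge0 => o _; exact: alg_prob_ge0.
Qed.

Lemma alg_in_sub A x S S' : S `<=` S' -> alg_in A x S <= alg_in A x S'.
Proof.
move=> SS; rewrite /alg_in [leLHS]big_mkcond [leRHS]big_mkcond/=.
apply: ler_sum => o _; case: ifPn => [/set_mem/SS oS|_].
  by rewrite mem_set.
by case: ifP => // _; exact: alg_prob_ge0.
Qed.

Lemma bmf_alg_in A S : bmf (fun x => alg_in A x S).
Proof.
split.
  rewrite /alg_in; under eq_fun do rewrite big_mkcond/=.
  apply: measurable_sum => o; case: (o \in S); first exact: alg_prob_measurable.
  exact: measurable_cst.
by exists 1 => x; rewrite ger0_norm ?alg_in_ge0 ?alg_in_le1.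
Qed.

Lemma solves_Ex A (T : task Z R O) (D : probability Z R) :
  solves T A -> task_valid T D ->
  2 / 3 <= Ex (iid (iid D m) n) (fun x => alg_in A x (task_correct T D)).
Proof.
by move=> sA vD; have := sA D vD; rewrite EFin_Ex ?lee_fin//; exact: bmf_alg_in.
Qed.

Lemma DP_ratio A eps x x' S : user_level_DP eps 0 A -> user_neighbors x x' ->
  alg_in A x S <= expR eps * alg_in A x' S.
Proof. by move=> H xx'; have := H x x' S xx'; rewrite addr0. Qed.

Lemma group_privacy A eps x x' S : user_level_DP eps 0 A ->
  alg_in A x S <= expR (eps * n%:R) * alg_in A x' S.
Proof.
(* The hybrid [y k] takes its first [k] users from [x'] and the others from [x], so consecutive
   hybrids are neighbors. *)
move=> H; pose y k : dataset Z n m := [tuple (if (i < k)%N then tnth x' i else tnth x i) | i < n].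
have step k : (k <= n)%N -> alg_in A x S <= expR (eps * k%:R) * alg_in A (y k) S.
  elim: k => [_|k IH kn].
    rewrite mulr0 expR0 mul1r (_ : y 0%N = x)//.
    by apply: eq_from_tnth => i; rewrite tnth_mktuple ltn0.
  apply: (le_trans (IH (ltnW kn))); rewrite -natr1 mulrDr mulr1 expRD -mulrA.
  apply: ler_wpM2l; first exact: expR_ge0.
  apply: DP_ratio => //; exists (Ordinal kn) => j jk.
  rewrite !tnth_mktuple [in RHS]ltnS [in RHS]leq_eqVlt.
  by case: eqVneq => // jk'; case/eqP: jk; apply: val_inj.
have -> : x' = y n by apply: eq_from_tnth => i; rewrite tnth_mktuple ltn_ord.
exact: step.
Qed.

End algorithms.

(** * Lower bounds from the VC dimension *)

Section packing.
Context (R : realType) (k : nat).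
Hypothesis k0 : (0 < k)%N.
Local Notation cube := {ffun 'I_k -> bool}.
Local Notation I := ('I_k * bool)%type.
Implicit Types (u : cube) (beta : R).

(** The point is uniform among [k], and its label agrees with [u] with probability [(1 + beta)/2].
    For [beta = 0] the law is uniform and the same for all [u]. *)
Definition biased beta u (ib : I) : R :=
  (2 * k%:R)^-1 * (1 + (if ib.2 == u ib.1 then beta else - beta)).

Let kp : 0 < k%:R :> R.
Proof. by rewrite ltr0n. Qed.

Lemma biased_gt0 beta u ib : 0 <= beta -> beta <= 1 / 2 -> 0 < biased beta u ib.
Proof.
move=> b0 b1; rewrite /biased mulr_gt0 ?invr_gt0 ?mulr_gt0//.
by case: ifP => _; lra.
Qed.

Lemma sum_cube_label (F : I -> R) u :
  \sum_ib F ib = \sum_i (F (i, u i) + F (i, ~~ u i)).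
Proof.
rewrite (eq_bigr (fun ib => F (ib.1, ib.2))); last by case.
rewrite -(pair_bigA _ (fun i b => F (i, b)))/=; apply: eq_bigr => i _.
by rewrite big_bool/=; case: (u i); rewrite // addrC.
Qed.

Lemma neqb_negb (b : bool) : (~~ b == b) = false.
Proof. by case: b. Qed.

Lemma sum_biased beta u : \sum_ib biased beta u ib = 1.
Proof.
rewrite (sum_cube_label _ u) (eq_bigr (fun=> k%:R^-1)); last first.
  by move=> i _; rewrite /biased/= eqxx neqb_negb; field; rewrite gt_eqF.
by rewrite sum_const_mul card_ord mulfV// gt_eqF.
Qed.

Lemma biased_chi2 beta u :
  \sum_ib biased beta u ib ^+ 2 / biased 0 u ib = 1 + beta ^+ 2.
Proof.
rewrite (sum_cube_label _ u) (eq_bigr (fun=> k%:R^-1 * (1 + beta ^+ 2))); last first.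
  move=> i _; rewrite /biased/= eqxx neqb_negb oppr0 addr0.
  by field; rewrite gt_eqF.
by rewrite sum_const_mul card_ord mulrA mulfV ?mul1r// gt_eqF.
Qed.

Lemma biased0 u v ib : biased 0 u ib = biased 0 v ib.
Proof. by rewrite /biased oppr0 !if_same. Qed.

(** The excess over the optimal error [(1 - beta)/2] is [beta] times the normalized Hamming distance
    to [u]: accuracy means proximity to [u]. *)
Lemma sum_biased_err beta u (h : 'I_k -> bool) :
  \sum_ib biased beta u ib * (h ib.1 != ib.2)%:R =
  (1 - beta) / 2 + beta / k%:R * #|[pred i | u i != h i]|%:R.
Proof.
rewrite (sum_cube_label _ u)
  (eq_bigr (fun i => (2 * k%:R)^-1 * (1 - beta) + beta / k%:R * (u i != h i)%:R)); last first.
  move=> i _; rewrite /biased/= eqxx neqb_negb.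
  by case: (u i); case: (h i); rewrite /= ?mulr0 ?mulr1; field; rewrite gt_eqF.
rewrite big_split/= sum_const_mul card_ord -mulr_sumr.
congr (_ + _ * _); first by field; rewrite gt_eqF.
by rewrite -sumr_const [RHS]big_mkcond/=; apply: eq_bigr => i _; rewrite inE; case: (_ != _).
Qed.

End packing.

Section packing_lower_bound.
Context (R : realType).

(* [F u t] plays the role of the probability that the algorithm, run on the
   dataset [t], lands in the Hamming ball of the sign vector [u]. *)
Lemma packing_average (k : nat) (J : finType) (P : {ffun 'I_k -> bool} -> J -> R) (Q : J -> R)
    (F : {ffun 'I_k -> bool} -> J -> R) (rho : R) :
  (0 < k)%N -> (forall j, 0 <= Q j) -> \sum_j Q j = 1 -> 0 <= rho ->
  (forall u, 2 / 3 <= \sum_j P u j * F u j) ->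
  (forall j, \sum_u F u j <= (6 / 5) ^+ k) ->
  (forall u, \sum_j P u j * F u j <= rho * \sum_j Q j * F u j) ->
  expR (k%:R / 10) <= rho.
Proof.
move=> k0 Q0 Q1 rho0 HP HF Hr.
have H1 : 2 ^+ k * (2 / 3) <= rho * (6 / 5) ^+ k.
  apply: (@le_trans _ _ (\sum_(u : {ffun 'I_k -> bool}) rho * \sum_j Q j * F u j)).
    rewrite (_ : 2 ^+ k * (2 / 3) = \sum_(u : {ffun 'I_k -> bool}) (2 / 3 : R)).
      by apply: ler_sum => u _; exact: le_trans (HP u) (Hr u).
    by rewrite sum_const_mul card_ffun card_bool card_ord natrX.
  rewrite -mulr_sumr; apply: ler_wpM2l => //.
  rewrite exchange_big/=; under eq_bigr do rewrite -mulr_sumr.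
  exact: sum_pmf_le.
(* As [k] is positive, [(2/3)^k <= 2/3]. This absorbs the success probability into the exponential,
   with base [(2 * (2/3)) / (6/5) = 10/9]. *)
have H2 : (10 / 9) ^+ k <= rho.
  rewrite -(ler_pM2r (x := (6 / 5) ^+ k)) ?exprn_gt0//.
  apply: le_trans H1; rewrite -exprMn (_ : 10 / 9 * (6 / 5) = 2 * (2 / 3)); last by field.
  rewrite exprMn; apply: ler_wpM2l; first exact: exprn_ge0.
  by rewrite -[leRHS]expr1; apply: ler_wiXn2l => //; lra.
apply: le_trans H2; rewrite [k%:R / 10]mulrC expRM_natr; apply: lerXn2r; rewrite ?nnegrE ?expR_ge0//.
by have := onemx_expR_le1 (10^-1 : R); lra.
Qed.

(** The counterpart of [packing_average] without a ratio condition on [F]. AM-GM bounds the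
    [P u]-mean of [F u] by a chi-square term plus a multiple of its [Q]-mean, using [F^2 <= F];
    averaged over [u], the [Q]-mean is at most [(3/5)^k]. *)
Lemma packing_average_chi2 (k : nat) (J : finType) (P : {ffun 'I_k -> bool} -> J -> R) (Q : J -> R)
    (F : {ffun 'I_k -> bool} -> J -> R) (chi : R) :
  (0 < k)%N -> (forall j, 0 < Q j) -> \sum_j Q j = 1 ->
  (forall u, \sum_j P u j = 1) -> (forall u, \sum_j P u j ^+ 2 / Q j <= chi) ->
  (forall u j, 0 <= F u j <= 1) ->
  (forall u, 2 / 3 <= \sum_j P u j * F u j) ->
  (forall j, \sum_u F u j <= (6 / 5) ^+ k) ->
  expR (k%:R / 201) <= chi.
Proof.
move=> k0 Q0 Q1 P1 Hchi F01 HP HF.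
have [y yE] : {y : R | y = (5 / 3) ^+ k} by eexists.
have yk : 5 / 3 <= y.
  by rewrite yE -[leLHS]expr1; apply: ler_weXn2l => //; lra.
have y0 : 0 < y by lra.
(* This [l] makes [(1 + l/2) / y] equal to [19/30], so at least [1/30] of the required [2/3] must
   come from the chi-square term. *)
have [l lE] : {l : R | l = 2 * (19 / 30 * y - 1)} by eexists.
have l0 : 0 < l by rewrite lE; lra.
have Hu u : 2 / 3 <= (chi - 1) / (2 * l) + (1 + l / 2) * \sum_j Q j * F u j.
  apply: (le_trans (HP u)).
  have -> : (chi - 1) / (2 * l) = (2 * l)^-1 * (chi - 1) by rewrite mulrC.
  have E2 : \sum_j (P u j - Q j) ^+ 2 / Q j = \sum_j P u j ^+ 2 / Q j - 1.
    transitivity (\sum_j (P u j ^+ 2 / Q j - 2 * P u j + Q j)).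
      by apply: eq_bigr => j _; field; rewrite gt_eqF.
    by rewrite big_split sumrB/= -mulr_sumr Q1 P1; lra.
  apply: (@le_trans _ _ (\sum_j ((2 * l)^-1 * ((P u j - Q j) ^+ 2 / Q j) + (1 + l / 2) * (Q j * F u j)))).
    apply: ler_sum => j _; have Qj := Q0 j.
    apply: (@le_trans _ _ ((2 * l)^-1 * ((P u j - Q j) ^+ 2 / Q j) + (Q j * F u j + l / 2 * (Q j * F u j ^+ 2)))).
      rewrite -subr_ge0 (_ : _ - _ = ((P u j - Q j) - l * Q j * F u j) ^+ 2 / (2 * l * Q j)).
        apply: divr_ge0; first exact: sqr_ge0.
        by rewrite !mulr_ge0 ?(ltW l0) ?(ltW Qj).
      by field; rewrite !gt_eqF.
    rewrite lerD2l mulrDl mul1r lerD2l; apply: ler_wpM2l; first lra.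
    apply: ler_wpM2l; first exact: ltW.
    by have /andP[f0 f1] := F01 u j; rewrite expr2 ler_piMr.
  rewrite big_split/= -!mulr_sumr E2 lerD2r; apply: ler_wpM2l; first by rewrite invr_ge0 mulr_ge0// ltW.
  by have := Hchi u; lra.
have avg : 2 / 3 <= (chi - 1) / (2 * l) + (1 + l / 2) * y^-1.
  have S : \sum_(u : {ffun 'I_k -> bool}) (2 / 3 : R) <=
      \sum_(u : {ffun 'I_k -> bool}) ((chi - 1) / (2 * l) + (1 + l / 2) * \sum_j Q j * F u j).
    exact: ler_sum.
  move: S; rewrite big_split/= !sum_const_mul card_ffun card_bool card_ord natrX -mulr_sumr.
  have T : \sum_(u : {ffun 'I_k -> bool}) \sum_j Q j * F u j <= (6 / 5) ^+ k.
    rewrite exchange_big/=; under eq_bigr do rewrite -mulr_sumr.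
    by apply: sum_pmf_le => // j; exact: ltW.
  have E65 : (6 / 5 : R) ^+ k = 2 ^+ k * y^-1.
    by rewrite yE -exprVn -exprMn; congr (_ ^+ _); field.
  rewrite E65 in T.
  have p2 : 0 < 2 ^+ k :> R by exact: exprn_gt0.
  move=> S; rewrite -(ler_pM2l p2) (le_trans S)// mulrDr lerD2l mulrCA.
  by apply: ler_wpM2l => //; lra.
have chi_l : l / 15 <= chi - 1.
  have E : (1 + l / 2) * y^-1 = 19 / 30 by rewrite lE; field; rewrite gt_eqF.
  rewrite E in avg; have : 1 / 30 <= (chi - 1) / (2 * l) by lra.
  by rewrite ler_pdivlMr ?mulr_gt0//; lra.
(* Although [l] grows like [(5/3)^k], it is only [1/9] at [k = 1]; the slow base [201/200] makes the
   bound valid from there on, by induction. *)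
suff : (201 / 200) ^+ k <= 1 + l / 15.
  move=> H; apply: (@le_trans _ _ (1 + l / 15)); last lra.
  apply: le_trans H; rewrite [k%:R / 201]mulrC expRM_natr; apply: lerXn2r; rewrite ?nnegrE ?expR_ge0//.
  by have := onemx_expR_le1 (201^-1 : R); lra.
rewrite lE {yk l0 Hu avg chi_l y0 l lE} yE {y yE HP HF P F P1 Hchi F01}.
case: k k0 => // k' _; elim: k' => [|k' IH]; first by rewrite !expr1; lra.
have b53 : 5 / 3 <= (5 / 3) ^+ k'.+1 :> R.
  by rewrite -[leLHS]expr1; apply: ler_weXn2l => //; lra.
rewrite (exprS _ k'.+1) (exprS (5 / 3) k'.+1); move: IH b53.
by set a := (201 / 200) ^+ _; set b := (5 / 3) ^+ _; lra.
Qed.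

End packing_lower_bound.

(** * The hard instances on a shattered set *)

Section vc_lower_bound.
Context (R : realType) (disp : measure_display) (X : measurableType disp).
Context (C : set (hypothesis X)) (S : {fset X}) (k : nat).
Context (alpha eps : R) (n m : nat) (A : algorithm (X * bool)%type R (hypothesis X) n m).
Hypotheses (shC : shatters C S) (Sk : #|` S| = k) (k0 : (0 < k)%N).
Hypotheses (a0 : 0 < alpha) (a1 : alpha <= 1 / 64) (e0 : 0 < eps) (m0 : (0 < m)%N).
Hypotheses (dpA : user_level_DP eps 0 A) (solA : solves (agn C alpha) A).
Local Notation cube := {ffun 'I_k -> bool}.
Local Notation I := ('I_k * bool)%type.

Let g (i : 'I_k) : X := nth point (enum_fset S) i.

Let gS i : g i \in S.
Proof. by apply: mem_nth; rewrite Sk. Qed.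

Let g_inj : injective g.
Proof.
move=> i j /eqP; rewrite nth_uniq ?fset_uniq//; last 2 first.
- by rewrite [size _]Sk.
- by rewrite [size _]Sk.
by move/eqP/val_inj.
Qed.

Let conc (u : cube) : exists2 c, C c & forall i, c (g i) = u i.
Proof.
have [c Cc Hc] := shC [set x | exists2 i, x = g i & u i].
exists c => // i; have Hi := Hc (g i) (gS i); apply/idP/idP.
  by move/(proj1 Hi) => [j /g_inj ->].
by move=> ui; apply: (proj2 Hi); exists i.
Qed.

(** With this bias, excess error [alpha] corresponds to Hamming distance [k/32], the radius of
    [ball]; [alpha <= 1/64] keeps the bias at most [1/2]. *)
Let beta := 32 * alpha.
Let b0 : 0 < beta. Proof. by rewrite mulr_gt0. Qed.
Let b1 : beta <= 1 / 2. Proof. by have := a1; rewrite /beta; lra. Qed.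
Let kp : 0 < k%:R :> R. Proof. by rewrite ltr0n. Qed.

Let gg (ib : I) : X * bool := (g ib.1, ib.2).
Let G (t : n.-tuple (m.-tuple I)) : dataset (X * bool)%type n m :=
  map_tuple (fun s => map_tuple gg s) t.
Let ball (u : cube) : set (hypothesis X) :=
  [set h | (32 * #|[pred i | u i != h (g i)]| <= k)%N].
Let F (u : cube) t : R := alg_in A (G t) (ball u).
Let P (u : cube) (t : n.-tuple (m.-tuple I)) : R := tw (@tw R I (biased beta u) m) t.
Let q (t : n.-tuple (m.-tuple I)) : R := tw (@tw R I (biased 0 ([ffun=> false] : cube)) m) t.

(** By shattering, some concept agrees with [u] on all the points and has error [(1 - beta)/2].
    Hence every correct output lies in the ball around [u]. *)
Let HP u : 2 / 3 <= \sum_t P u t * F u t.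
Proof.
have [D HD] := fin_law_exists gg (fun ib => ltW (biased_gt0 k0 u ib (ltW b0) b1)) (sum_biased k0 beta u).
have H := solves_Ex solA (D := D) Logic.I.
have := fin_law_iid (n := n) (fin_law_iid (n := m) HD) (bmf_alg_in A (ball u)).
rewrite /F /P /G => <-; apply: (le_trans H); apply: le_Ex.
- exact: bmf_alg_in.
- exact: bmf_alg_in.
move=> x; apply: alg_in_sub => h /=.
have errE h' : err D h' = (1 - beta) / 2 + beta / k%:R * #|[pred i | u i != h' (g i)]|%:R.
  rewrite /err HD; last exact: bmf_miss.
  exact: (sum_biased_err k0 beta u (fun i => h' (g i))).
have [c Cc Hc] := conc u.
rewrite Err_err => Hh.
have : ((err D h)%:E <= (err D c)%:E + alpha%:E)%E.
  apply: (le_trans Hh); rewrite leeD2r//; apply: ereal_inf_lbound.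
  by exists c => //; rewrite Err_err.
rewrite -EFinD lee_fin !errE (_ : #|[pred i | u i != c (g i)]| = 0%N); last first.
  by apply: eq_card0 => i; rewrite !inE Hc eqxx.
rewrite mulr0 addr0 lerD2l -(ler_pM2r kp).
rewrite /ball/= -(ler_nat R) natrM; set N := #|_|%:R.
rewrite (_ : beta / k%:R * N * k%:R = beta * N); last by field; rewrite gt_eqF.
have := a0; rewrite /beta => a0' H'; rewrite -(ler_pM2l a0'); lra.
Qed.

(** Exchange the sums: each possible output lies in the balls of at most [(6/5)^k] sign vectors, and
    the output probabilities sum to one. *)
Let HF t : \sum_u F u t <= (6 / 5) ^+ k.
Proof.
rewrite /F; set x := G t.
have E u : alg_in A x (ball u) =
    \sum_(o <- alg_outputs A) alg_prob A x o * (o \in ball u)%:R.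
  rewrite /alg_in big_mkcond/=; apply: eq_bigr => o _.
  by case: (o \in ball u); rewrite ?mulr1 ?mulr0.
under eq_bigr do rewrite E.
rewrite exchange_big/=.
apply: (@le_trans _ _ (\sum_(o <- alg_outputs A) alg_prob A x o * (6 / 5) ^+ k)).
  apply: ler_sum => o _; rewrite -mulr_sumr; apply: ler_wpM2l; first exact: alg_prob_ge0.
  apply: le_trans (hamming_ball R [ffun i => o (g i)]).
  rewrite -sum1_card natr_sum [leRHS](_ : _ = \sum_(u : cube)
    (if (32 * #|[pred i | u i != [ffun i => o (g i)] i]| <= k)%N then 1 else 0)); last first.
    by rewrite big_mkcond; apply: eq_bigr => u _; rewrite inE.
  apply: ler_sum => u _.
  have EE : #|[pred i | u i != o (g i)]| = #|[pred i | u i != [ffun i => o (g i)] i]|.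
    by apply: eq_card => i; rewrite !inE ffunE.
  rewrite -EE; case: (boolP (o \in ball u)) => [/set_mem/= ->//|_].
  by case: ifP.
by rewrite -mulr_suml alg_prob_sum1 mul1r.
Qed.

Let F0 u t : 0 <= F u t. Proof. exact: alg_in_ge0. Qed.
Let F1 u t : F u t <= 1. Proof. exact: alg_in_le1. Qed.

Let Fr u (t t' : n.-tuple (m.-tuple I)) :
  (exists i, forall j, j != i -> tnth t j = tnth t' j) -> F u t <= expR eps * F u t'.
Proof.
move=> [i Hi]; apply: DP_ratio => //; exists i => j ji.
by rewrite !tnth_map Hi.
Qed.

Let bi0 (u : cube) (ib : I) : 0 < biased beta u ib.
Proof. exact: (biased_gt0 k0 u ib (ltW b0) b1). Qed.
Let bq0 (ib : I) : 0 < biased 0 ([ffun=> false] : cube) ib :> R.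
Proof. by apply: biased_gt0 => //; have := b0; have := b1; lra. Qed.
Let q0 t : 0 < q t.
Proof. by apply: tw_gt0 => s; apply: tw_gt0. Qed.
Let q1 : \sum_t q t = 1.
Proof. by rewrite !sum_tw sum_biased// !expr1n. Qed.
Let P1 u : \sum_t P u t = 1.
Proof. by rewrite !sum_tw sum_biased// !expr1n. Qed.
Let chi2 (u : cube) : \sum_ib biased beta u ib ^+ 2 / biased 0 ([ffun=> false] : cube) ib = 1 + beta ^+ 2.
Proof.
rewrite -(biased_chi2 k0 beta u); apply: eq_bigr => ib _.
by rewrite (biased0 R [ffun=> false] u ib).
Qed.

(** Exchanging one user's whole sample costs a factor [expR eps], whatever the bias. This bound
    settles the case of large [beta^2 m] below and later absorbs an additive constant in the bound
    on [d]. *)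
Lemma vc_lower_user : k%:R / 10 <= eps * n%:R.
Proof.
rewrite -ler_expR.
apply: (@packing_average R k _ P q F) => //.
- by move=> t; exact: ltW.
- move=> u; rewrite expRM_natr.
  apply: (tensor_ratio (c := expR eps)) => //.
  + by move=> s; apply: tw_ge0 => ib; exact: ltW.
  + by move=> s; apply: tw_ge0 => ib; exact: ltW.
  + move=> f f0 fr; apply: trivial_ratio_step => //.
    * by move=> s; apply: tw_ge0 => ib; exact: ltW.
    * by rewrite sum_tw sum_biased// expr1n.
    * by move=> s; apply: tw_ge0 => ib; exact: ltW.
    * by rewrite sum_tw sum_biased// expr1n.
  + exact: Fr.
Qed.

(** A user's [m] samples have chi-square divergence of order [beta^2 m] from uniform. By privacy,
    exchanging the user then costs only a factor [1 + O(beta * sqrt m * eps)]. *)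
Lemma vc_lower_private : eps <= 1 / 2 ->
  k%:R <= 1280 * (alpha * eps * Num.sqrt m%:R) * n%:R.
Proof.
move=> e1; set r := Num.sqrt m%:R.
have r0 : 0 <= r by exact: sqrtr_ge0.
have rr : r ^+ 2 = m%:R by rewrite sqr_sqrtr// ler0n.
have n0 : 0 <= n%:R :> R by rewrite ler0n.
(* If [beta^2 m] exceeds [1/2], then [2 * beta * r >= 1] and [vc_lower_user] is already stronger.
   Otherwise the chi-square divergence can be linearized. *)
have [bm|bm] := leP (beta ^+ 2 * m%:R) (1 / 2); last first.
  have br : 1 <= 2 * beta * r.
    rewrite leNgt; apply/negP => lt1.
    have : (2 * beta * r) ^+ 2 <= 1 by rewrite expr_le1 ?(ltW lt1)// mulr_ge0// mulr_ge0// ltW.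
    by rewrite (_ : _ ^+ 2 = 4 * (beta ^+ 2 * r ^+ 2)); [rewrite rr; lra | ring].
  have := vc_lower_user; rewrite /beta in br.
  have en : 0 <= eps * n%:R by rewrite mulr_ge0// ltW.
  by nra.
have rp : 0 < r by rewrite sqrtr_gt0 ltr0n.
have ee : expR eps - 1 <= 2 * eps.
  by have := expR_le1D2 (ltW e0) e1; lra.
have ee0 : 0 < expR eps - 1 by rewrite subr_gt0 expR_gt1.
have sp : 0 < 2 * beta * r by rewrite !mulr_gt0.
have rho0 : 0 <= 1 + 2 * beta * r * (expR eps - 1).
  by apply: addr_ge0 => //; apply: mulr_ge0; exact: ltW.
have : expR (k%:R / 10) <= (1 + 2 * beta * r * (expR eps - 1)) ^+ n.
  apply: (@packing_average R k _ P q F) => //.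
  - by move=> t; exact: ltW.
  - exact: exprn_ge0.
  - move=> u.
    apply: (tensor_ratio (c := expR eps)) => //.
    + by move=> s; apply: tw_ge0 => ib; exact: ltW.
    + by move=> s; apply: tw_ge0 => ib; exact: ltW.
    + move=> f f0 fr; apply: chi2_ratio_step => //.
      * by move=> s; apply: tw_gt0.
      * by rewrite sum_tw sum_biased// expr1n.
      * by rewrite sum_tw sum_biased// expr1n.
      * rewrite tw_div_sum chi2 [leRHS](_ : _ = 4 * (beta ^+ 2 * r ^+ 2)); last by ring.
        rewrite rr.
        have b2 : 0 <= beta ^+ 2 * m%:R by rewrite mulr_ge0 ?sqr_ge0.
        have b3 : (1 + beta ^+ 2) ^+ m <= expR (beta ^+ 2 * m%:R).
          by apply: exprn_le_expR; have := sqr_ge0 beta; lra.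
        by have := expR_le1D2 b2 bm; lra.
    + exact: Fr.
move=> H; have {}H : expR (k%:R / 10) <= expR (2 * beta * r * (expR eps - 1) * n%:R).
  apply: (le_trans H); apply: exprn_le_expR.
  by have := rho0; lra.
rewrite ler_expR in H.
have H2 : 2 * beta * r * (expR eps - 1) * n%:R <= 2 * beta * r * (2 * eps) * n%:R.
  by apply: ler_wpM2r => //; apply: ler_wpM2l => //; exact: ltW.
by move: H2 H; rewrite /beta; lra.
Qed.

(** Privacy is set aside here: the chi-square quantity of all [n m] samples is at most
    [exp(beta^2 m n)], and packing requires it to be exponential in [k]. The factor [1024] is
    [32^2]. *)
Lemma vc_lower_sample : k%:R <= 1024 * 201 * (alpha ^+ 2 * m%:R) * n%:R.
Proof.
have : expR (k%:R / 201) <= expR (beta ^+ 2 * m%:R * n%:R).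
  apply: (@packing_average_chi2 R k _ P q F) => //.
  + move=> u; rewrite tw_div_sum (eq_bigr _ (fun s _ => erefl)) tw_div_sum chi2.
    rewrite expRM_natr; apply: lerXn2r; rewrite ?nnegrE ?expR_ge0 ?exprn_ge0 ?addr_ge0 ?sqr_ge0//.
    by apply: exprn_le_expR; have := sqr_ge0 beta; lra.
  + by move=> u t; rewrite F0 F1.
by rewrite ler_expR /beta exprMn; lra.
Qed.

End vc_lower_bound.

Lemma pushforward_law (R : realType) (d d' : measure_display) (T : measurableType d)
    (T' : measurableType d') (D : probability T R) (phi : T -> T') :
  measurable_fun setT phi ->
  exists D' : probability T' R, forall f, bmf f -> Ex D' f = Ex D (fun x => f (phi x)).
Proof.
move=> mphi.
pose mf : {mfun T >-> T'} := HB.pack phi (isMeasurableFun.Build _ _ _ _ phi mphi).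
exists (distribution D mf) => f bf.
rewrite /Ex /Rintegral integral_distribution//; last exact: (bmf_integrable D (bmf_comp mphi bf)).
by apply/measurable_EFinP; case: bf.
Qed.

(** * Probabilistic representations and priors *)

Section representation.
Context (R : realType) (disp : measure_display) (X : measurableType disp).
Implicit Types (C : set (hypothesis X)) (c h : hypothesis X) (D : probability X R).

(* By [PRDim_prior] and [PRDim_le_prior], a class has such a prior with
   [a = 1/4] and [gamma = exp(-d)], up to constants, iff its dimension is [d]. *)
Definition prior C (a gamma : R) (I : finType) (p : I -> R) (h : I -> hypothesis X) :=
  [/\ forall i, 0 <= p i, \sum_i p i = 1 &
      forall c D, C c -> gamma <= \sum_(i | dis D c (h i) <= a) p i].

Lemma le_ln_nat (k l : nat) : (k <= l)%N -> ln (k%:R : R) <= ln (l%:R : R).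
Proof.
case: k => [_|k kl]; first by rewrite ln0//; case: l => [|l]; [rewrite ln0 | rewrite ln_ge0// ler1n].
by rewrite ler_ln ?posrE ?ltr0n ?ler_nat// (leq_trans _ kl).
Qed.

Lemma is_pmf_pos (P : {fset hypothesis X} -> R) : is_pmf P -> exists H, 0 < P H.
Proof.
move=> [P0 P1]; apply: contrapT => noH; have := P1.
rewrite esum1; first by move/esym/eqP; rewrite onee_eq0.
move=> H _; congr (_%:E); apply/eqP; rewrite eq_le P0 andbT leNgt.
by apply/negP => PH; apply: noH; exists H.
Qed.

Lemma PRDim_ge0 C (d : R) : PRDim R C = d%:E -> 0 <= d.
Proof.
move=> Cd; rewrite -lee_fin -Cd; apply: le_ereal_inf_tmp => _ [P [pmfP _] <-].
have [H PH] := is_pmf_pos pmfP.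
apply: (@le_trans _ _ (ln (#|` H|%:R : R))%:E).
  by rewrite lee_fin -(ln0 (lexx (0 : R))); exact: (@le_ln_nat 0).
by apply: ereal_sup_ubound; exists H.
Qed.

(** Draw [H] from a nearly optimal representation, then a uniform element of [H]: a good [H] yields
    a good hypothesis with probability at least [1/#|H|]. The factor [6/10] pays for a failure
    probability of [1/4], a truncation and a slack of [1/20] in the size. *)
Lemma PRDim_prior C (d : R) : PRDim R C = d%:E ->
  exists (I : finType) (p : I -> R) (h : I -> hypothesis X),
    prior C (1 / 4) (6 / 10 * expR (- d)) p h.
Proof.
move=> Cd.
have e0 : 0 < 1 / 20 :> R by lra.
have fC : PRDim R C \is a fin_num by rewrite Cd.
have [_ [P [pmfP repP] <-] sizeP] := lb_ereal_inf_adherent e0 fC.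
rewrite -/(PRDim R C) Cd -EFinD in sizeP.
have [P0 P1] := pmfP.
(* The support may be infinite, so a finite part [A] of mass above [9/10] is kept; the good sets in
   it retain mass [9/10 - 1/4 = 65/100]. *)
have : ((9 / 10)%:E < \esum_(H in [set: {fset hypothesis X}]) (P H)%:E)%E.
  by rewrite P1 lte_fin; lra.
move=> /ereal_sup_gt[_ [A [finA _] <-]]; rewrite fsbig_finite// => massA.
pose A' := fset_set A.
rewrite sumEFin lte_fin in massA.
pose wt (H : {fset hypothesis X}) : R := P H / #|` H|%:R.
have wt0 H : 0 <= wt H by rewrite divr_ge0.
pose L0 : seq (R * hypothesis X) := [seq (wt H, h) | H <- A', h <- enum_fset H].
pose z := \sum_(x <- L0) x.1.
have zA : z = \sum_(H <- A') (wt H * #|` H|%:R).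
  rewrite /z big_allpairs_dep/=; apply: eq_bigr => H _.
  by rewrite big_const_seq count_predT iter_addr addr0 mulr_natr.
have sumA1 : \sum_(H <- A') P H <= 1.
  rewrite -lee_fin -P1 -sumEFin; apply: esum_ge; exists A => //.
  by rewrite fsbig_finite.
have z1 : z <= 1.
  rewrite zA; apply: le_trans sumA1; apply: ler_sum => H _; rewrite /wt.
  have [->|H0] := eqVneq #|` H|%:R (0 : R); first by rewrite mulr0.
  by rewrite mulfVK.
(* The mass lost to the truncation and to an empty [H] goes to an arbitrary hypothesis, so that the
   weights sum to one. *)
pose h0 : hypothesis X := cst false.
pose L := (1 - z, h0) :: L0.
exists 'I_(size L), (fun i => (tnth (in_tuple L) i).1), (fun i => (tnth (in_tuple L) i).2).
have L_ge0 x : x \in L -> 0 <= x.1.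
  rewrite inE => /predU1P[->/=|/allpairsPdep[H [h [_ _ ->]]]]; last exact: wt0.
  by rewrite subr_ge0.
split.
- by move=> i; apply: L_ge0; exact: mem_tnth.
- by rewrite -(big_tnth _ _ L xpredT (fun x => x.1)) big_cons -/z subrK.
move=> c D Cc.
rewrite -(big_tnth _ _ L (fun x => dis D c x.2 <= 1 / 4) (fun x => x.1)).
pose good := [set H : {fset hypothesis X} | exists2 h, h \in H & (D [set x | c x != h x] <= (1 / 4)%:E)%E].
have bad : \sum_(H <- A' | H \notin good) P H <= 1 / 4.
  have PT := P1; rewrite (esumID good) ?setTI// in PT; last by move=> H _; rewrite lee_fin.
  have rep : (_ <= \esum_(H in good) (P H)%:E)%E := repP c Cc D.
  have fin : ((\sum_(H <- A' | H \notin good) P H)%:E <= \esum_(H in ~` good) (P H)%:E)%E.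
    rewrite esum_mkcond; apply: esum_ge; exists A => //.
    rewrite fsbig_finite//= big_mkcond -sumEFin lee_sum// => H _.
    by rewrite in_setC; case: ifP => // _; rewrite lee_fin.
  by have := leeD rep fin; rewrite PT -EFinD lee_fin; lra.
have goodA : 65 / 100 <= \sum_(H <- A' | H \in good) P H.
  by move: massA; rewrite (bigID (fun H => H \in good))/=; lra.
rewrite big_cons; set S := \sum_(j <- L0 | _) _.
apply: (@le_trans _ _ S); last first.
  by case: ifP => // _; rewrite lerDr subr_ge0.
have expd : 19 / 20 * expR (- d) <= expR (- (d + 1 / 20)).
  rewrite opprD expRD mulrC; apply: ler_wpM2l; first exact: expR_ge0.
  by apply: le_trans (expR_ge1Dx _); lra.
apply: (@le_trans _ _ (expR (- (d + 1 / 20)) * \sum_(H <- A' | H \in good) P H)).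
  apply: (@le_trans _ _ (19 / 20 * expR (- d) * (65 / 100))).
    by have := expR_gt0 (- d); lra.
  by apply: ler_pM.
rewrite mulr_sumr /S [leLHS]big_mkcond [leRHS]big_mkcond/= big_allpairs_dep/=.
apply: ler_sum => H _; case: ifPn => [/set_mem[h hH]|_]; last first.
  by apply: sumr_ge0 => h _; case: ifP.
rewrite dis_prob lee_fin => hgood.
rewrite (bigD1_seq h)//= hgood -[leLHS]addr0; apply: lerD; last first.
  by apply: sumr_ge0 => h' _; case: ifP.
have [PH0|PHN] := eqVneq (P H) 0; first by rewrite PH0 mulr0.
have PHp : 0 < P H by rewrite lt_neqAle eq_sym PHN P0.
have H0 : (0 < #|` H|)%N by rewrite cardfs_gt0; apply/fset0Pn; exists h.
have Hle : #|` H|%:R <= expR (d + 1 / 20) :> R.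
  rewrite -[leLHS]lnK ?posrE ?ltr0n// ler_expR -lee_fin.
  by apply/ltW; apply: le_lt_trans sizeP; apply: ereal_sup_ubound; exists H.
rewrite /wt mulrC ler_pM2l// expRN lef_pV2 ?posrE ?expR_gt0// ltr0n//.
Qed.

Lemma esum_finite_pushforward (K : choiceType) (J : finType) (f : J -> K) (w : J -> R)
    (G : set K) : (forall j, 0 <= w j) ->
  (\esum_(k in G) (\sum_(j | f j == k) w j)%:E = (\sum_(j | f j \in G) w j)%:E)%E.
Proof.
move=> w0.
under eq_esum => k _ do rewrite big_mkcond -sumEFin.
rewrite esum_sum; last by move=> k j _ _; case: ifP; rewrite lee_fin.
rewrite [in RHS]big_mkcond/= -sumEFin; apply: eq_bigr => j _.
rewrite esum_mkcond (esumID [set f j]); last first.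
  by move=> k _; case: ifP => // _; case: ifP; rewrite lee_fin.
rewrite setTI [X in (_ + X)%E]esum1 ?adde0; last first.
  by move=> k [_ /= /eqP]; rewrite eq_sym => /negbTE ->; case: ifP.
rewrite esum_set1 ?eqxx; first by case: ifP.
by case: ifP => // _; rewrite lee_fin.
Qed.

Lemma prior_all_miss (I : finType) (p : I -> R) (g : pred I) M :
  (forall i, 0 <= p i) -> \sum_i p i = 1 ->
  \sum_(t : M.-tuple I | ~~ has g t) tw p t = (1 - \sum_(i | g i) p i) ^+ M.
Proof.
move=> p0 p1.
(* Setting the weights on [g] to zero turns the sum over tuples avoiding [g] into an unrestricted
   one, which factors. *)
pose p' i := if g i then 0 else p i.
have -> : 1 - \sum_(i | g i) p i = \sum_i p' i.
  rewrite -p1 (bigID g)/= addrAC subrr add0r big_mkcond/=.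
  by apply: eq_bigr => i _; rewrite /p'; case: (g i).
rewrite -sum_tw big_mkcond/=; apply: eq_bigr => t _.
case: ifPn => [|/negPn]; rewrite /tw.
  rewrite -all_predC => /allP allt; rewrite !big_seq; apply: eq_bigr => i it.
  by rewrite /p' (negbTE (allt i it)).
move=> /hasP[i it gi]; rewrite (big_rem i it)/= /p' gi mul0r.
by [].
Qed.

(** The set of [M] independent draws from the prior is a representation. It misses every
    approximation of a given concept with probability at most [(1 - gamma)^M]. *)
Lemma PRDim_le_prior C (gamma : R) (I : finType) (p : I -> R) (h : I -> hypothesis X) M :
  prior C (1 / 4) gamma p h -> gamma <= 1 -> (1 - gamma) ^+ M <= 1 / 4 -> (0 < M)%N ->
  (PRDim R C <= (ln (M%:R : R))%:E)%E.
Proof.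
move=> [p0 p1 Hp] g1 gM M0.
pose f (t : M.-tuple I) : {fset hypothesis X} := [fset x in map h t]%fset.
pose P H := \sum_(t | f t == H) tw p t.
have tp0 (t : M.-tuple I) : 0 <= tw p t by exact: tw_ge0.
apply: (@le_trans _ _ (prob_size P)).
  apply: ereal_inf_lbound; exists P => //; split; first split.
  - by move=> H; apply: sumr_ge0.
  - rewrite (esum_finite_pushforward f setT tp0) (eq_bigl xpredT); last by move=> t; rewrite in_setT.
    by rewrite sum_tw p1 expr1n.
  move=> c Cc D; rewrite (esum_finite_pushforward f _ tp0) lee_fin.
  pose g i := dis D c (h i) <= 1 / 4.
  apply: (@le_trans _ _ (\sum_(t : M.-tuple I | has g t) tw p t)).
    have := sum_tw p M; rewrite p1 expr1n (bigID (fun t : M.-tuple I => has g t))/=.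
    rewrite (prior_all_miss g M p0 p1).
    have : (1 - \sum_(i | g i) p i) ^+ M <= (1 - gamma) ^+ M.
      apply: lerXn2r; rewrite ?nnegrE; last by have := Hp c D Cc; rewrite /g; lra.
        by rewrite -p1 (bigID g)/= addrAC subrr add0r sumr_ge0.
      by rewrite subr_ge0.
    by lra.
  rewrite big_mkcond [leRHS]big_mkcond/=; apply: ler_sum => t _.
  case: ifPn => [/hasP[i it gi]|_]; last by case: ifP.
  rewrite mem_set//; exists (h i); last by rewrite dis_prob lee_fin.
  by rewrite !inE; apply/mapP; exists i.
apply: ge_ereal_sup => _ [H /= PH <-]; rewrite lee_fin; apply: le_ln_nat.
have [t ft] : exists t, f t == H.
  apply: contrapT => not; move: PH; rewrite /P big1 ?ltxx// => t ft.
  by case: not; exists t.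
by rewrite -(eqP ft) card_fseq (leq_trans (size_undup _))// size_map size_tuple.
Qed.

(** A finite supremum of integers is attained: a shattered set of size above [k - 1/2] has size
    [k]. *)
Lemma VCdim_attained C (k : nat) : VCdim R C = k%:R%:E ->
  exists2 S, shatters C S & #|` S| = k.
Proof.
move=> Ck; have [_ [S shS <-]] : exists2 y, [set (#|` S|%:R : R)%:E | S in shatters C] y &
    ((k%:R - 1 / 2)%:E < y)%E.
  by apply: ereal_sup_gt; rewrite -/(VCdim R C) Ck lte_fin; lra.
move=> kS; exists S => //.
have Sk : ((#|` S|%:R : R)%:E <= k%:R%:E)%E.
  by rewrite -Ck; apply: ereal_sup_ubound; exists S.
rewrite lee_fin ler_nat in Sk; rewrite lte_fin in kS.
apply/eqP; rewrite eqn_leq Sk /= -ltnS -(ltr_nat R) -natr1; lra.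
Qed.

Lemma two_concepts_VC C c c' x (k : nat) : VCdim R C = k%:R%:E -> C c -> C c' -> c x != c' x ->
  (0 < k)%N.
Proof.
move=> Ck Cc Cc' cc'.
have : ((#|` [fset x]%fset|%:R : R)%:E <= k%:R%:E)%E.
  rewrite -Ck; apply: ereal_sup_ubound; exists [fset x]%fset => // S'.
  have [b0|b0] := pselect (S' x).
    have [ct|cf] := boolP (c x).
      by exists c => // y; rewrite inE => /eqP ->; rewrite ct.
    exists c' => // y; rewrite inE => /eqP ->.
    by move: cc' cf; case: (c x); case: (c' x).
  have [ct|cf] := boolP (c x).
    exists c' => // y; rewrite inE => /eqP ->.
    by move: cc' ct; case: (c x); case: (c' x).
  by exists c => // y; rewrite inE => /eqP ->; split=> // cx; rewrite cx in cf.
by rewrite cardfs1 lee_fin ler_nat.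
Qed.

(** If no two concepts differ, a single hypothesis represents the class exactly, with size
    [ln 1 = 0]. *)
Lemma PRDim_gt0_two_concepts C (d : R) : PRDim R C = d%:E -> 0 < d ->
  exists c c' x, [/\ C c, C c' & c x != c' x].
Proof.
move=> Cd d0; apply: contrapT => noc.
suff : (PRDim R C <= (ln (1%:R : R))%:E)%E by rewrite ln1 Cd lee_fin leNgt d0.
pose h0 : hypothesis X := if pselect (exists c, C c) is left e then projT1 (cid e) else cst false.
apply: (@PRDim_le_prior C 1 unit (fun=> 1) (fun=> h0) 1) => //; last by rewrite subrr expr1.
split=> //; first by rewrite big_const card_unit /= addr0.
move=> c D Cc; rewrite (big_pred1 tt)//= => -[].
have -> : h0 = c.
  rewrite /h0; case: pselect => [e|[]]; last by exists c.
  case: (cid e) => /= c' Cc'; apply/mfuneqP => x.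
  by apply/eqP; apply: contrapT => /negP cc'; apply: noc; exists c', c, x.
rewrite /dis (_ : differ _ _ _ = fun=> 0).
  by rewrite Ex_cst divr_ge0.
by apply/funext => x; rewrite /differ eqxx.
Qed.

End representation.

(** * The lower bound from group privacy *)

Section privacy_lower_bound.
Context (R : realType) (disp : measure_display) (X : measurableType disp).

(** The output law on the fixed dataset [x0] is a prior for the class. Given [c] and [D], label [D]
    by [c]: the correct outputs are [1/4]-close to [c], are likely on some dataset, and by group
    privacy keep probability [gamma] on [x0]. *)
Lemma PRDim_lower (C : set (hypothesis X)) (d alpha eps : R) n m
    (A : algorithm (X * bool)%type R (hypothesis X) n m) :
  PRDim R C = d%:E -> alpha <= 1 / 4 ->
  user_level_DP eps 0 A -> solves (agn C alpha) A -> 0 <= eps ->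
  d <= eps * n%:R + 2.
Proof.
move=> Cd a1 dpA solA e0.
pose x0 : dataset (X * bool)%type n m := nseq_tuple n (nseq_tuple m point).
pose I : finType := alg_outputs A.
pose p (i : I) := alg_prob A x0 (val i).
pose h (i : I) : hypothesis X := val i.
have en0 : 0 <= eps * n%:R by rewrite mulr_ge0.
have ge1 : 1 <= expR (eps * n%:R) by rewrite -[leLHS]expR0 ler_expR.
pose gamma : R := 1 / 2 * expR (- (eps * n%:R)).
have gE : gamma * expR (eps * n%:R) = 1 / 2.
  by rewrite /gamma -(mulrA (1 / 2)) -expRD addNr expR0 mulr1.
have g0 : 0 < gamma by rewrite mulr_gt0 ?expR_gt0.
have g1 : gamma <= 1 by move: gE ge1 g0; nra.
have pr : prior C (1 / 4) gamma p h.
  split.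
  - by move=> i; exact: alg_prob_ge0.
  - rewrite -(alg_prob_sum1 A x0) big_seq_fsetE//.
  move=> c D Cc.
  pose lab (x : X) : X * bool := (x, c x).
  have mlab : measurable_fun setT lab by apply: measurable_fun_pair.
  have [D' HD'] := pushforward_law D mlab.
  have errE h' : err D' h' = dis D c h'.
    rewrite /err HD'; last exact: bmf_miss.
    by congr Ex; apply/funext => x; rewrite /miss /differ/= eq_sym.
  pose G := task_correct (agn C alpha) D'.
  have Gsub : G `<=` [set h' | dis D c h' <= 1 / 4].
    move=> h' /= Gh; rewrite -errE -lee_fin -Err_err; apply: (le_trans Gh).
    have inf0 : (ereal_inf [set Err D' c' | c' in C] <= 0)%E.
      apply: ereal_inf_lbound; exists c => //; rewrite Err_err errE /dis.
      rewrite (_ : differ _ _ _ = fun=> 0) ?Ex_cst//.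
      by apply/funext => x; rewrite /differ eqxx.
    apply: (@le_trans _ _ (0 + alpha%:E)%E); first by rewrite leeD2r.
    by rewrite add0e lee_fin.
  (* A mean success probability of [2/3] leaves some dataset with success at least [1/2]. *)
  have [x Hx] : exists x, 1 / 2 <= alg_in A x G.
    apply: contrapT => nox.
    have := solves_Ex solA (D := D') Logic.I.
    have : Ex (iid (iid D' m) n) (fun x => alg_in A x G) <= 1 / 2.
      apply: Ex_le_cst; first exact: bmf_alg_in.
      by move=> x; rewrite leNgt; apply/negP => /ltW Hx; apply: nox; exists x.
    by rewrite -/G; lra.
  have H1 := group_privacy x x0 G dpA.
  have H2 : alg_in A x0 G <= \sum_(i | dis D c (h i) <= 1 / 4) p i.
    apply: (le_trans (alg_in_sub A x0 Gsub)).
    rewrite /alg_in big_seq_fsetE/= le_eqVlt; apply/orP; left; apply/eqP.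
    by apply: eq_bigl => i; apply/idP/idP => [/set_mem//|H]; exact: mem_set.
  apply: le_trans H2; rewrite /gamma mulrC expRN ler_pdivrMl ?expR_gt0//.
  exact: le_trans Hx H1.
(* With more than [y] draws, [gamma * M >= 2], so all miss with probability at most
   [exp(-2) <= 1/4]; and [5 <= exp(2)] turns the size [ln M] into [eps * n + 2]. *)
pose y := 4 * expR (eps * n%:R).
have y0 : 0 <= y by rewrite mulr_ge0// expR_ge0.
have /andP[t1 t2] := truncn_itv y0.
set M := (Num.trunc y).+1 in t2.
have M1 : M%:R <= 5 * expR (eps * n%:R) :> R.
  by rewrite /M -natr1; move: t1 ge1; rewrite /y; lra.
have e5 := expR2_ge5 R.
have gM : (1 - gamma) ^+ M <= 1 / 4.
  apply: (@le_trans _ _ (expR (- gamma * M%:R))).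
    by apply: exprn_le_expR; lra.
  apply: (@le_trans _ _ (expR (- 2))).
    rewrite ler_expR mulNr lerN2.
    apply: (@le_trans _ _ (gamma * y)); last by apply: ler_wpM2l; apply/ltW.
    by rewrite /y mulrCA gE; lra.
  by rewrite expRN -[leRHS]invrK lef_pV2 ?posrE ?invr_gt0 ?expR_gt0//; lra.
have := PRDim_le_prior pr g1 gM (ltn0Sn _); rewrite Cd lee_fin => /le_trans; apply.
apply: (@le_trans _ _ (ln (expR (eps * n%:R + 2)))); last by rewrite expRK.
rewrite ler_ln ?posrE ?ltr0n ?expR_gt0//; apply: (le_trans M1).
by rewrite expRD mulrC; apply: ler_wpM2l => //; exact: expR_ge0.
Qed.

End privacy_lower_bound.

(** * Boosting a prior *)

Section boosting.
Context (R : realType) (disp : measure_display) (X : measurableType disp).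
Implicit Types (c h : hypothesis X) (s : seq (hypothesis X)) (D : probability X R).

Definition majority_fun s (x : X) : bool :=
  (size s < 2 * count (fun h : hypothesis X => h x) s)%N.

Lemma measurable_majority s : measurable_fun setT (majority_fun s).
Proof.
rewrite (_ : majority_fun s = fun x => (size s)%:R < 2 * \sum_(h <- s) (h x)%:R :> R); last first.
  apply/funext => x; rewrite /majority_fun -(ltr_nat R) natrM; congr (_ < _ * _).
  by rewrite -sum1_count natr_sum big_mkcond/=; apply: eq_bigr => h _; case: (h x).
apply: measurable_fun_ltr; first exact: measurable_cst.
apply: measurable_funM; first exact: measurable_cst.
apply: measurable_sum => h.
exact: (@measurableT_comp _ _ _ _ _ _ (fun b : bool => b%:R : R)).
Qed.

HB.instance Definition _ s :=
  isMeasurableFun.Build _ _ _ _ (majority_fun s) (measurable_majority s).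

Definition majority s : hypothesis X := majority_fun s.

(** The multiplicative weight of [x] in boosting: each hypothesis of [s] that is right at [x]
    divides it by three. *)
Definition potential c s (x : X) : R := \prod_(h <- s) (1 / 3 + 2 / 3 * differ R c h x).

Lemma bmf_reweight c h : bmf (fun x => 1 / 3 + 2 / 3 * differ R c h x).
Proof. by apply: bmfD; [exact: bmf_cst | apply: bmfZ; exact: bmf_differ]. Qed.

Lemma bmf_potential c s : bmf (potential c s).
Proof. by apply: bmf_prod => h; exact: bmf_reweight. Qed.

Lemma potential_ge0 c s x : 0 <= potential c s x.
Proof.
apply: prodr_ge0 => h _; rewrite /differ; case: (c x != h x); rewrite /=; lra.
Qed.

Lemma potentialE c s x :
  potential c s x = (1 / 3) ^+ count (fun h : hypothesis X => h x == c x) s.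
Proof.
rewrite /potential; elim: s => [|h s IH]; first by rewrite big_nil.
rewrite big_cons IH /= exprD /differ [c x == _]eq_sym; congr (_ * _).
by case: (h x == c x); rewrite /= ?expr1 ?expr0; lra.
Qed.

Lemma majority_wrong c s x k : size s = (2 * k)%N -> c x != majority s x ->
  (count (fun h : hypothesis X => h x == c x) s <= k)%N.
Proof.
move=> sk; rewrite /= /majority_fun sk; have := count_predC (fun h : hypothesis X => h x) s.
rewrite sk; set a := count _ s; set b := count _ s; case cx: (c x) => ab.
  rewrite (@eq_count _ _ (fun h : hypothesis X => h x)) -/a; last by move=> h /=; rewrite eqb_id.
  by case: ltnP => // H _; lia.
rewrite (@eq_count _ _ (predC (fun h : hypothesis X => h x))) -/b; last by move=> h /=; rewrite eqbF_neg.
by case: ltnP => // H _; lia.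
Qed.

(** Where the majority errs, ties included, at most [k] of the [2k] hypotheses are right, so the
    potential is at least [3^-k]. *)
Lemma differ_majority c s x k : size s = (2 * k)%N ->
  differ R c (majority s) x <= 3 ^+ k * potential c s x.
Proof.
move=> sk; rewrite /differ; case: (boolP (c x != _)) => [|_] /=; last first.
  by rewrite mulr_ge0 ?exprn_ge0 ?potential_ge0.
move=> /(majority_wrong sk) H; rewrite potentialE.
apply: (@le_trans _ _ (3 ^+ k * (1 / 3) ^+ k)).
  by rewrite -exprMn mulrC divfK// expr1n.
apply: ler_wpM2l; first exact: exprn_ge0.
by apply: ler_wiXn2l => //; lra.
Qed.

Lemma integral_mrestr_ge0 D (E : set X) (mE : measurable E) (f : X -> R) :
  measurable_fun setT f -> (forall x, 0 <= f x) ->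
  (\int[mrestr D mE]_x (f x)%:E = \int[D]_(x in E) (f x)%:E)%E.
Proof.
move=> mf f0.
have mf' A : measurable_fun A (fun x => (f x)%:E) by apply/measurable_EFinP; exact: measurable_funTS.
have mEC := measurableC mE.
have f0' x : (E `|` ~` E) x -> (0 <= (f x)%:E)%E by rewrite lee_fin.
rewrite -(setUv E) ge0_integral_setU//; last exact/disj_setPCl.
rewrite (@eq_measure_integral _ _ _ E D (mrestr D mE)); last first.
  by move=> A mA AE; rewrite /= /mrestr setIidl.
rewrite (@eq_measure_integral _ _ _ (~` E) mzero (mrestr D mE)); last first.
  by move=> A mA AE; rewrite /= /mrestr (_ : A `&` E = set0) ?measure0//; apply/seteqP; split => // x [/AE].
by rewrite integral_measure_zero adde0.
Qed.

(** One boosting step: [D'] has density proportional to [1/3] where [h] is right and [1] where it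
    errs. It is built as a multiple of [D] plus a multiple of [D] restricted to the errors. *)
Lemma reweight D c h : exists D' : probability X R, forall f, bmf f -> (forall x, 0 <= f x) ->
  Ex D (fun x => (1 / 3 + 2 / 3 * differ R c h x) * f x) =
  (1 / 3 + 2 / 3 * dis D c h) * Ex D' f.
Proof.
pose E := [set x | c x != h x].
have mE : measurable E.
  rewrite -[E]setTI; exact: (measurable_differ c h measurableT (Y := [set true])).
have t1 : 0 <= 1 / 3 :> R by lra.
have t2 : 0 <= 2 / 3 :> R by lra.
pose mu := measure_add (mscale (NngNum t1) D) (mscale (NngNum t2) (mrestr D mE)).
have int_mu f : bmf f -> (forall x, 0 <= f x) -> (\int[mu]_x (f x)%:E)%E =
    (Ex D (fun x => (1 / 3 + 2 / 3 * differ R c h x) * f x))%:E.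
  move=> bf f0; have [mf _] := bf.
  have mf' : measurable_fun setT (fun x => (f x)%:E) by exact/measurable_EFinP.
  have f0' x : setT x -> (0 <= (f x)%:E)%E by rewrite lee_fin.
  rewrite ge0_integral_measure_add// !ge0_integral_mscale//= integral_mrestr_ge0//.
  have -> : (\int[D]_(x in E) (f x)%:E = \int[D]_x (differ R c h x * f x)%:E)%E.
    rewrite integral_mkcond; apply: eq_integral => x _; rewrite patchE /differ.
    case: (boolP (x \in E)) => [/set_mem/= ->|xE]; first by rewrite mul1r.
    have cf : (c x != h x) = false by apply: contraNF xE => cx; exact: mem_set.
    by rewrite cf mul0r.
  have bdf : bmf (fun x => differ R c h x * f x) by apply: bmfM => //; exact: bmf_differ.
  rewrite !EFin_Ex// -!EFinM -EFinD; congr (_%:E).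
  rewrite -!ExZ// -ExD; [|exact: bmfZ|exact: bmfZ].
  by congr Ex; apply/funext => x; ring.
have W0 : 0 < 1 / 3 + 2 / 3 * dis D c h.
  have : 0 <= dis D c h by apply: Ex_ge_cst => //; exact: bmf_differ.
  by lra.
have muT : mu setT = (1 / 3 + 2 / 3 * dis D c h)%:E.
  have := int_mu (fun=> 1) (bmf_cst X 1) (fun=> ler01).
  rewrite (_ : (\int[mu]_x 1%:E)%E = mu setT); last by rewrite integral_cst// mul1e.
  move=> ->; congr (_%:E); under eq_fun do rewrite mulr1.
  rewrite ExD; [|exact: bmf_cst|by apply: bmfZ; exact: bmf_differ].
  by rewrite Ex_cst ExZ//; exact: bmf_differ.
have [D' HD'] := normalized_measure W0 muT.
exists D' => f bf f0.
have : (Ex D' f)%:E = ((1 / 3 + 2 / 3 * dis D c h)^-1 *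
    Ex D (fun x => (1 / 3 + 2 / 3 * differ R c h x) * f x))%:E.
  by rewrite -EFin_Ex// HD' ?int_mu//; case: bf.
by case=> DE; rewrite DE mulVKf// gt_eqF.
Qed.

(** Since the prior serves every distribution, each draw is [1/4]-accurate for the current
    reweighted one with probability at least [gamma], whatever the earlier draws. Each such draw
    multiplies the mean potential by at most [1/3 + (2/3)(1/4) = 1/2]. *)
Lemma boost_potential C (gamma : R) (I : finType) (p : I -> R) (h : I -> hypothesis X) :
  prior C (1 / 4) gamma p h -> 0 <= gamma -> forall n c D, C c ->
  gamma ^+ n <= \sum_(t : n.-tuple I | Ex D (potential c (map h t)) <= (1 / 2) ^+ n) tw p t.
Proof.
move=> [p0 p1 Hp] g0; elim=> [|n IH] c D Cc.
  rewrite big_mkcond sum_tuple0 expr0 tw0 (_ : potential c (map h [tuple]) = fun=> 1).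
    by rewrite Ex_cst expr0 lexx.
  by apply/funext => x; rewrite /potential big_nil.
rewrite big_mkcond sum_tuple_cons.
apply: (@le_trans _ _ (\sum_(i | dis D c (h i) <= 1 / 4) p i * gamma ^+ n)).
  rewrite -mulr_suml exprS; apply: ler_wpM2r; first exact: exprn_ge0.
  exact: Hp.
rewrite [leLHS]big_mkcond/=; apply: ler_sum => i _; case: ifPn => [di|_]; last first.
  by apply: sumr_ge0 => t _; case: ifP => // _; exact: tw_ge0.
have [D' HD'] := reweight D c (h i).
apply: (@le_trans _ _ (p i * \sum_(t : n.-tuple I | Ex D' (potential c (map h t)) <= (1 / 2) ^+ n) tw p t)).
  by apply: ler_wpM2l => //; exact: IH.
rewrite mulr_sumr [leLHS]big_mkcond/=; apply: ler_sum => t _; case: ifPn => [dt|_]; last first.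
  by case: ifP => // _; exact: tw_ge0.
rewrite tw_cons ifT//.
rewrite (_ : potential c _ = fun x => (1 / 3 + 2 / 3 * differ R c (h i) x) * potential c (map h t) x).
  rewrite HD'; [|exact: bmf_potential|exact: potential_ge0].
  rewrite exprS; apply: ler_pM => //.
  - have : 0 <= dis D c (h i) by apply: Ex_ge_cst => //; exact: bmf_differ.
    by lra.
  - by apply: Ex_ge_cst; [exact: bmf_potential | exact: potential_ge0].
  - by lra.
by apply/funext => x; rewrite /potential big_cons.
Qed.

(** The error of the majority is at most [3^k] times the mean potential, hence at most
    [3^k 2^(-2k) = (3/4)^k]. *)
Lemma boosted_prior C (gamma : R) (I : finType) (p : I -> R) (h : I -> hypothesis X) k :
  prior C (1 / 4) gamma p h -> 0 <= gamma ->
  prior C ((3 / 4) ^+ k) (gamma ^+ (2 * k)) (fun t : (2 * k).-tuple I => tw p t)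
    (fun t => majority (map h t)).
Proof.
move=> pr g0; have [p0 p1 Hp] := pr; split.
- by move=> t; exact: tw_ge0.
- by rewrite sum_tw p1 expr1n.
move=> c D Cc; apply: (le_trans (boost_potential pr g0 (2 * k) D Cc)).
rewrite [leLHS]big_mkcond [leRHS]big_mkcond/=; apply: ler_sum => t _.
case: ifPn => [dt|_]; last by case: ifP => // _; exact: tw_ge0.
rewrite ifT//.
apply: (@le_trans _ _ (3 ^+ k * Ex D (potential c (map h t)))).
  rewrite -ExZ; last exact: bmf_potential.
  apply: le_Ex.
  - exact: bmf_differ.
  - by apply: bmfZ; exact: bmf_potential.
  - by move=> x; apply: differ_majority; rewrite size_map size_tuple.
apply: (@le_trans _ _ (3 ^+ k * (1 / 2) ^+ (2 * k))).
  by apply: ler_wpM2l => //; exact: exprn_ge0.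
by rewrite exprM -exprMn le_eqVlt; apply/orP; left; apply/eqP; congr (_ ^+ _); field.
Qed.

End boosting.

(** * Private selection among finitely many hypotheses *)

Section clipping.
Context (R : realType).
Implicit Types (B y s : R).

Definition clip B y : R := Num.max (- B) (Num.min y B).

Lemma clip_bounded B y : 0 <= B -> `|clip B y| <= B.
Proof.
move=> B0; rewrite ler_norml /clip le_max lexx /= ge_max ge_min lexx orbT andbT.
by lra.
Qed.

Lemma clip_le B x y : x <= y -> clip B x <= clip B y.
Proof.
move=> xy; rewrite /clip ge_max !le_max lexx /=; apply/orP; right.
by rewrite le_min !ge_min xy lexx orbT.
Qed.

Lemma le_expR_div s y : 0 < s -> y <= s^-1 * expR (s * y).
Proof.
move=> s0; rewrite ler_pdivlMl// (le_trans _ (expR_ge1Dx _))//; lra.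
Qed.

(** The bias of clipping is the overshoot beyond [-B], which is dominated by an exponential; moment
    generating functions then control its mean. *)
Lemma clip_ub B s y : 0 < s -> 0 <= B -> clip B y <= y + s^-1 * expR (s * (- y - B)).
Proof.
move=> s0 B0; have e0 : 0 <= s^-1 * expR (s * (- y - B)) by rewrite mulr_ge0 ?expR_ge0 ?invr_ge0 ?ltW.
have := le_expR_div (- y - B) s0.
by rewrite /clip ge_max ge_min => H; apply/andP; split; [lra | apply/orP; left; lra].
Qed.

Lemma clip_lb B s y : 0 < s -> 0 <= B -> y - s^-1 * expR (s * (y - B)) <= clip B y.
Proof.
move=> s0 B0; have e0 : 0 <= s^-1 * expR (s * (y - B)) by rewrite mulr_ge0 ?expR_ge0 ?invr_ge0 ?ltW.
have := le_expR_div (y - B) s0.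
by rewrite /clip le_max le_min => H; apply/orP; right; apply/andP; split; lra.
Qed.

Lemma bmf_clip (d : measure_display) (T : measurableType d) B (f : T -> R) :
  0 <= B -> bmf f -> bmf (fun x => clip B (f x)).
Proof.
move=> B0 [mf _]; split; last by exists B => x; exact: clip_bounded.
apply: measurable_maxr; first exact: measurable_cst.
by apply: measurable_minr => //; exact: measurable_cst.
Qed.

Lemma measurable_inv_pos (d : measure_display) (T : measurableType d) (f : T -> R) :
  (forall x, 0 < f x) -> measurable_fun setT f -> measurable_fun setT (fun x => (f x)^-1).
Proof.
move=> f0 mf; rewrite (_ : (fun x => _) = (fun x => expR (- ln (f x)))); last first.
  by apply/funext => x; rewrite expRN lnK// posrE.
apply: measurableT_comp => //; apply: measurable_funN.
exact: (@measurableT_comp _ _ _ _ _ _ (@ln R)).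
Qed.

End clipping.

(** * Concentration of the clipped comparison of one user *)

Section one_user.
Context (R : realType) (disp : measure_display) (X : measurableType disp).
Context (D : probability (X * bool)%type R) (m : nat).
Implicit Types (h : hypothesis X) (z : m.-tuple (X * bool)).

Definition gap h h' z : R := m%:R^-1 * \sum_(y <- z) (miss R h y - miss R h' y).

Lemma bmf_gap h h' : bmf (gap h h').
Proof.
apply: bmfZ; apply: bmf_tuple_sum; apply: bmfB; exact: bmf_miss.
Qed.

Let dev h h' y := miss R h y - miss R h' y - (err D h - err D h').

Lemma bmf_dev h h' : bmf (dev h h').
Proof. by apply: bmfB; [apply: bmfB; exact: bmf_miss | exact: bmf_cst]. Qed.

Lemma dev_mean h h' : Ex D (dev h h') = 0.
Proof.
rewrite ExB; [|by apply: bmfB; exact: bmf_miss|exact: bmf_cst].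
rewrite ExB; [|exact: bmf_miss|exact: bmf_miss].
by rewrite Ex_cst subrr.
Qed.

Lemma err_ge0 h : 0 <= err D h.
Proof. by apply: Ex_ge_cst => [|y]; [exact: bmf_miss | rewrite /miss]. Qed.

Lemma err_le1 h : err D h <= 1.
Proof. by apply: Ex_le_cst => [|y]; [exact: bmf_miss | rewrite /miss; case: (_ != _)]. Qed.

Lemma dev_bounded h h' y : `|dev h h' y| <= 2.
Proof.
have b1 := err_ge0 h; have b2 := err_ge0 h'; have b3 := err_le1 h; have b4 := err_le1 h'.
rewrite ler_norml /dev /miss; case: (h _ != _); case: (h' _ != _) => /=; apply/andP; split; lra.
Qed.

Lemma gap_dev h h' z : (0 < m)%N ->
  gap h h' z - (err D h - err D h') = m%:R^-1 * \sum_(y <- z) dev h h' y.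
Proof.
move=> m0; rewrite /gap /dev [in RHS]sumrB big_const_seq count_predT size_tuple iter_addr addr0.
by rewrite -(mulr_natl (err D h - err D h') m) mulrBr mulKf// pnatr_eq0 -lt0n.
Qed.

Lemma gap_mean h h' : (0 < m)%N -> Ex (iid D m) (fun z => gap h h' z - (err D h - err D h')) = 0.
Proof.
move=> m0; under eq_fun do rewrite gap_dev//.
rewrite ExZ; last by apply: bmf_tuple_sum; exact: bmf_dev.
by rewrite iid_Ex_sum ?dev_mean ?mulr0//; exact: bmf_dev.
Qed.

Lemma bmf_center h h' : bmf (fun z => gap h h' z - (err D h - err D h')).
Proof. by apply: bmfB; [exact: bmf_gap | exact: bmf_cst]. Qed.

(** Per example, the deviation has mean zero and absolute value at most 2, and [|l| <= m/6] keeps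
    the exponent below [1/3]. The quadratic bound on the exponential then gives [1 + 4 q^2] with
    [q = l/m], raised to the power [m] by independence. *)
Lemma gap_mgf h h' (l : R) : (0 < m)%N -> `|l| <= m%:R / 6 ->
  Ex (iid D m) (fun z => expR (l * (gap h h' z - (err D h - err D h')))) <=
  expR (4 * l ^+ 2 / m%:R).
Proof.
move=> m0 lm; have mp : 0 < m%:R :> R by rewrite ltr0n.
set q := l / m%:R.
have q6 : `|q| <= 1 / 6.
  by rewrite normrM normfV (ger0_norm (ltW mp)) ler_pdivrMr// mulrC; lra.
have qd y : q * dev h h' y <= 1 / 3.
  apply: le_trans (ler_norm _) _; rewrite normrM.
  apply: (@le_trans _ _ (1 / 6 * 2)); last lra.
  by apply: ler_pM => //; exact: dev_bounded.
have bq : bmf (fun y => expR (q * dev h h' y)) by apply: bmf_expR; apply: bmfZ; exact: bmf_dev.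
under eq_fun => z.
  rewrite gap_dev// mulrA -/q mulr_sumr expR_sum.
  over.
rewrite iid_Ex_prod//.
have step : Ex D (fun y => expR (q * dev h h' y)) <= 1 + 4 * q ^+ 2.
  have -> : 1 + 4 * q ^+ 2 = Ex D (fun y => (1 + 4 * q ^+ 2) + q * dev h h' y).
    rewrite ExD ?Ex_cst ?ExZ ?dev_mean ?mulr0 ?addr0//.
    - exact: bmf_dev.
    - exact: bmf_cst.
    - by apply: bmfZ; exact: bmf_dev.
  apply: le_Ex => //.
    by apply: bmfD; [exact: bmf_cst | apply: bmfZ; exact: bmf_dev].
  move=> y; apply: le_trans (expR_le1DxDx2 (qd y)) _.
  have d4 : dev h h' y ^+ 2 <= 4.
    by have := dev_bounded h h' y; rewrite ler_norml => /andP[]; nra.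
  have : q ^+ 2 * dev h h' y ^+ 2 <= q ^+ 2 * 4 by apply: ler_wpM2l => //; exact: sqr_ge0.
  by lra.
apply: (@le_trans _ _ ((1 + 4 * q ^+ 2) ^+ m)).
  apply: lerXn2r => //; rewrite nnegrE.
    by apply: Ex_ge_cst => // y; exact: expR_ge0.
  by rewrite addr_ge0// mulr_ge0// sqr_ge0.
apply: (@le_trans _ _ (expR (4 * q ^+ 2 * m%:R))).
  by apply: exprn_le_expR; have := sqr_ge0 q; lra.
by rewrite ler_expR /q le_eqVlt; apply/orP; left; apply/eqP; field; rewrite gt_eqF.
Qed.

Variables (alpha B : R).
Hypotheses (m0 : (0 < m)%N) (a0 : 0 < alpha)
  (BE : B = alpha / 2 + 6 * ln (128 / alpha) / Num.sqrt m%:R) (a1 : alpha <= 1).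

(** At the scale [sqrt m] the moment generating function is bounded by a constant: the exponent in
    [gap_mgf] becomes [1/9]. *)
Let s : R := Num.sqrt m%:R / 6.

Let rp : 1 <= Num.sqrt m%:R :> R.
Proof. by rewrite -[leLHS]sqrtr1; apply: ler_wsqrtr; rewrite ler1n. Qed.

Let s0 : 0 < s.
Proof. by rewrite /s; have := rp; lra. Qed.

Let s6 : 1 / 6 <= s.
Proof. by rewrite /s; have := rp; lra. Qed.

Let rr : Num.sqrt m%:R ^+ 2 = m%:R :> R.
Proof. by rewrite sqr_sqrtr// ler0n. Qed.

Lemma B_ge : alpha / 2 <= B.
Proof.
rewrite BE lerDl divr_ge0 ?sqrtr_ge0// mulr_ge0// ln_ge0//.
by rewrite ler_pdivlMr//; have := a1; lra.
Qed.

Let B0 : 0 <= B.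
Proof. by have := B_ge; have := a0; lra. Qed.

Lemma tail_mgf h h' (l : R) : `|l| = s ->
  Ex (iid D m) (fun z => expR (l * (gap h h' z - (err D h - err D h')))) <= 11 / 9.
Proof.
move=> ls.
have l2 : l ^+ 2 = m%:R / 36.
  rewrite -[l ^+ 2]real_normK ?num_real// ls /s.
  by rewrite (_ : _ ^+ 2 = Num.sqrt m%:R ^+ 2 / 36); [rewrite rr | field].
apply: (le_trans (gap_mgf _ _ m0 _)).
  rewrite ls /s; have := rp; have := rr; set r := Num.sqrt _ => <- r1; nra.
rewrite l2 (_ : 4 * (m%:R / 36) / m%:R = 1 / 9); last first.
  by field; rewrite pnatr_eq0 -lt0n.
by apply: (le_trans (expR_le1D2 _ _)); lra.
Qed.

(** The logarithm in [B] is chosen to make the exponential equal to [alpha/128]; the remaining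
    factors [s^-1 <= 6] and [11/9] fit in the slack. *)
Lemma tail_small : s^-1 * (expR (s * (alpha / 2 - B)) * (11 / 9)) <= alpha / 16.
Proof.
have E : s * (alpha / 2 - B) = - ln (128 / alpha).
  by rewrite BE /s; field; rewrite gt_eqF// (lt_le_trans _ rp).
rewrite E expRN lnK ?posrE ?divr_gt0// [(128 / alpha)^-1]invf_div.
have sV : s^-1 <= 6 by rewrite -[leRHS]invrK lef_pV2 ?posrE ?invr_gt0//; have := s6; lra.
have sV0 : 0 < s^-1 by rewrite invr_gt0.
have := a0 => ap.
apply: (@le_trans _ _ (6 * (alpha / 128 * (11 / 9)))); last lra.
by apply: ler_wpM2r => //; lra.
Qed.

Lemma clip_gap_upper h h' : err D h <= err D h' ->
  Ex (iid D m) (fun z => clip B (gap h h' z)) <= alpha / 16.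
Proof.
move=> hh.
pose W z := gap h h' z - (err D h - err D h').
have bW : bmf W by exact: bmf_center.
have bE : bmf (fun z => expR (- s * W z)) by apply: bmf_expR; exact: bmfZ.
apply: (@le_trans _ _ (Ex (iid D m) (fun z => W z + s^-1 * expR (- s * B) * expR (- s * W z)))).
  apply: le_Ex.
  - by apply: bmf_clip => //; exact: bmf_gap.
  - by apply: bmfD => //; exact: bmfZ.
  move=> z; apply: (@le_trans _ _ (clip B (W z))); first by apply: clip_le; rewrite /W; lra.
  apply: (le_trans (clip_ub (W z) s0 B0)).
  rewrite -mulrA -expRD le_eqVlt; apply/orP; left; apply/eqP.
  by congr (_ + _ * expR _); ring.
rewrite ExD//; last exact: bmfZ.
rewrite ExZ// gap_mean// add0r.
have tm : Ex (iid D m) (fun z => expR (- s * W z)) <= 11 / 9.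
  by apply: tail_mgf; rewrite normrN ger0_norm// ltW.
apply: le_trans tail_small; rewrite -mulrA ler_pM2l ?invr_gt0//.
apply: ler_pM => //.
- by apply: Ex_ge_cst => // z; exact: expR_ge0.
- by rewrite ler_expR mulNr -mulrN ler_pM2l//; have := a0; lra.
Qed.

(** By monotonicity of the clip the margin may be lowered to exactly [alpha/2], which the first term
    of [B] leaves unclipped. The clipping bias then costs at most [alpha/16]. *)
Lemma clip_gap_lower h h' : err D h' + alpha / 2 <= err D h ->
  7 / 16 * alpha <= Ex (iid D m) (fun z => clip B (gap h h' z)).
Proof.
move=> hh.
pose W z := gap h h' z - (err D h - err D h').
have bW : bmf W by exact: bmf_center.
have bE : bmf (fun z => expR (s * W z)) by apply: bmf_expR; exact: bmfZ.
have bE' : bmf (fun z => s^-1 * expR (s * (alpha / 2 - B)) * expR (s * W z)) by exact: bmfZ.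
have bW' : bmf (fun z => W z + alpha / 2) by apply: bmfD => //; exact: bmf_cst.
apply: (@le_trans _ _ (Ex (iid D m) (fun z => (W z + alpha / 2)
    - s^-1 * expR (s * (alpha / 2 - B)) * expR (s * W z)))); last first.
  apply: le_Ex.
  - exact: bmfB.
  - by apply: bmf_clip => //; exact: bmf_gap.
  move=> z; apply: (@le_trans _ _ (clip B (W z + alpha / 2))); last by apply: clip_le; rewrite /W; lra.
  apply: le_trans (clip_lb (W z + alpha / 2) s0 B0).
  rewrite -mulrA -expRD le_eqVlt; apply/orP; left; apply/eqP.
  by congr (_ - _ * expR _); ring.
rewrite ExB// ExZ// ExD//; last exact: bmf_cst.
rewrite gap_mean// add0r Ex_cst.
have tm : Ex (iid D m) (fun z => expR (s * W z)) <= 11 / 9.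
  by apply: tail_mgf; rewrite ger0_norm// ltW.
have : s^-1 * expR (s * (alpha / 2 - B)) * Ex (iid D m) (fun z => expR (s * W z)) <= alpha / 16.
  apply: le_trans tail_small; rewrite -mulrA ler_pM2l ?invr_gt0// ler_pM2l ?expR_gt0//.
by lra.
Qed.

(* The exponential moment of the difference of the two clipped comparisons pays
   at once for the sampling error and for the randomness of the mechanism. *)
Lemma comparison_mgf h h1 h2 (g : R) : 0 <= g -> g <= alpha / (32 * B ^+ 2) ->
  err D h <= err D h1 -> err D h + alpha / 2 <= err D h2 ->
  Ex (iid D m) (fun z => expR (g * (clip B (gap h h1 z) - clip B (gap h2 h z)))) <=
  expR (- (g * alpha / 4)).
Proof.
move=> g0 gB e1 e2.
have Ba := B_ge; have ap := a0; have Bp : 0 < B by lra.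
have gB2 : g * (32 * B ^+ 2) <= alpha by rewrite -ler_pdivlMr// mulr_gt0// exprn_gt0.
have gB1 : g * B <= 1 / 16 by nra.
pose u z := clip B (gap h h1 z) - clip B (gap h2 h z).
have bu : bmf u by apply: bmfB; apply: bmf_clip => //; exact: bmf_gap.
have u2 z : `|u z| <= 2 * B.
  rewrite /u (le_trans (ler_normB _ _))//.
  by have := clip_bounded (gap h h1 z) B0; have := clip_bounded (gap h2 h z) B0; lra.
have Eu : Ex (iid D m) u <= - (3 / 8 * alpha).
  rewrite ExB; [|by apply: bmf_clip => //; exact: bmf_gap|by apply: bmf_clip => //; exact: bmf_gap].
  by have := clip_gap_upper e1; have := clip_gap_lower e2; lra.
have step : Ex (iid D m) (fun z => expR (g * u z)) <= 1 + g * Ex (iid D m) u + 4 * g ^+ 2 * B ^+ 2.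
  apply: (@le_trans _ _ (Ex (iid D m) (fun z => (1 + 4 * g ^+ 2 * B ^+ 2) + g * u z))).
    apply: le_Ex.
    - by apply: bmf_expR; exact: bmfZ.
    - by apply: bmfD; [exact: bmf_cst | exact: bmfZ].
    move=> z; have := u2 z; rewrite ler_norml => /andP[ua ub].
    have gu : g * u z <= 1 / 3.
      by apply: (@le_trans _ _ (g * (2 * B))); [exact: ler_wpM2l | lra].
    apply: (le_trans (expR_le1DxDx2 gu)).
    have u4 : u z ^+ 2 <= 4 * B ^+ 2 by nra.
    have : g ^+ 2 * u z ^+ 2 <= g ^+ 2 * (4 * B ^+ 2) by apply: ler_wpM2l => //; exact: sqr_ge0.
    by rewrite exprMn; lra.
  rewrite ExD; [|exact: bmf_cst|exact: bmfZ].
  by rewrite Ex_cst ExZ//; lra.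
(* The bound on [g] makes the quadratic term at most [g * alpha / 8], leaving [-3/8 + 1/8 = -1/4] of
   [g * alpha]. *)
apply: (le_trans step); apply: le_trans (expR_ge1Dx _).
have : g * Ex (iid D m) u <= g * - (3 / 8 * alpha) by exact: ler_wpM2l.
have : g * (g * (32 * B ^+ 2)) <= g * alpha by exact: ler_wpM2l.
by lra.
Qed.

End one_user.

(** * The selection mechanism *)

Section mechanism.
Context (R : realType) (disp : measure_display) (X : measurableType disp).
Context (I : finType) (p : I -> R) (H : I -> hypothesis X) (M n m : nat) (B g : R).
Hypotheses (p0 : forall i, 0 <= p i) (p1 : \sum_i p i = 1) (M0 : (0 < M)%N)
  (B0 : 0 <= B) (g0 : 0 <= g).
Local Notation data := (dataset (X * bool)%type n m).
Implicit Types (h : hypothesis X) (x : data) (t : M.-tuple I) (l : 'I_M).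

Definition score h h' x : R := \sum_(z <- x) clip B (gap R h h' z).

(* [g^-1 ln (soft t x l)] is a smooth proxy for the largest clipped margin by
   which hypothesis [l] loses against another candidate. *)
Definition soft t x l : R :=
  \sum_(l' < M) expR (g * score (H (tnth t l)) (H (tnth t l')) x).

(** The exponential mechanism with rate [g] applied to the smooth proxy: [(soft t x l)^-1] is the
    exponential of minus [g] times it. *)
Definition sel t x l : R := (soft t x l)^-1 / \sum_(l' < M) (soft t x l')^-1.

(** The candidates [t] are drawn from the prior independently of the data, so privacy reduces to
    that of [sel] for fixed [t]. *)
Definition mprob x (o : hypothesis X) : R :=
  \sum_(t : M.-tuple I) tw p t * \sum_(l < M) (H (tnth t l) == o)%:R * sel t x l.

Lemma bmf_score h h' : bmf (score h h').
Proof. by apply: bmf_tuple_sum; apply: bmf_clip => //; exact: bmf_gap. Qed.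

Lemma bmf_soft t l : bmf (fun x => soft t x l).
Proof. by apply: bmf_sum => l'; apply: bmf_expR; apply: bmfZ; exact: bmf_score. Qed.

Lemma soft_ge t x l l' : expR (g * score (H (tnth t l)) (H (tnth t l')) x) <= soft t x l.
Proof.
rewrite /soft (bigD1 l')//= lerDl; apply: sumr_ge0 => ? _; exact: expR_ge0.
Qed.

Lemma soft_gt0 t x l : 0 < soft t x l.
Proof. exact: lt_le_trans (expR_gt0 _) (soft_ge t x l l). Qed.

Lemma sum_soft_ge t x l : (soft t x l)^-1 <= \sum_(l' < M) (soft t x l')^-1.
Proof.
rewrite (bigD1 l)//= lerDl; apply: sumr_ge0 => l' _.
by rewrite invr_ge0 ltW// soft_gt0.
Qed.

Lemma sum_soft_gt0 t x : 0 < \sum_(l' < M) (soft t x l')^-1.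
Proof.
by apply: lt_le_trans (sum_soft_ge t x (Ordinal M0)); rewrite invr_gt0 soft_gt0.
Qed.

Lemma sel_ge0 t x l : 0 <= sel t x l.
Proof. by rewrite divr_ge0 ?invr_ge0 ?(ltW (soft_gt0 _ _ _)) ?(ltW (sum_soft_gt0 _ _)). Qed.

Lemma sum_sel t x : \sum_(l < M) sel t x l = 1.
Proof. by rewrite -mulr_suml mulfV// gt_eqF// sum_soft_gt0. Qed.

Lemma sel_le1 t x l : sel t x l <= 1.
Proof.
rewrite -(sum_sel t x) (bigD1 l)//= lerDl; apply: sumr_ge0 => ? _; exact: sel_ge0.
Qed.

Lemma bmf_sel t l : bmf (fun x => sel t x l).
Proof.
split; last by exists 1 => x; rewrite ger0_norm ?sel_ge0 ?sel_le1.
have mi l' : measurable_fun setT (fun x => (soft t x l')^-1).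
  by apply: measurable_inv_pos => [x|]; [exact: soft_gt0 | case: (bmf_soft t l')].
apply: measurable_funM => //; apply: measurable_inv_pos => [x|]; first exact: sum_soft_gt0.
exact: measurable_sum.
Qed.

Lemma bmf_mprob o : bmf (mprob ^~ o).
Proof.
apply: bmf_sum => t; apply: bmfZ; apply: bmf_sum => l; apply: bmfZ; exact: bmf_sel.
Qed.

Lemma mprob_ge0 x o : 0 <= mprob x o.
Proof.
apply: sumr_ge0 => t _; rewrite mulr_ge0 ?tw_ge0// sumr_ge0// => l _.
by rewrite mulr_ge0// sel_ge0.
Qed.

Definition outputs : {fset hypothesis X} := [fset h in [seq H i | i <- enum I]]%fset.

Lemma mem_outputs i : H i \in outputs.
Proof. by rewrite !inE; apply/mapP; exists i; rewrite ?mem_enum. Qed.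

Lemma mprob_sum x (G : pred (hypothesis X)) :
  \sum_(o <- outputs | G o) mprob x o =
  \sum_(t : M.-tuple I) tw p t * \sum_(l < M) (G (H (tnth t l)))%:R * sel t x l.
Proof.
rewrite exchange_big/=; apply: eq_bigr => t _; rewrite -mulr_sumr exchange_big/=.
congr (_ * _); apply: eq_bigr => l _; rewrite -mulr_suml; congr (_ * _).
rewrite big_mkcond (bigD1_seq (H (tnth t l)) (mem_outputs _) (fset_uniq _))/=.
rewrite [X in _ + X]big1 ?addr0 ?eqxx.
  by case: (G _).
by move=> o; rewrite eq_sym => /negbTE ->; case: ifP.
Qed.

Lemma mprob_supp x o : o \notin outputs -> mprob x o = 0.
Proof.
move=> oN; rewrite /mprob big1// => t _; rewrite big1 ?mulr0// => l _.
by case: eqP => [E|_]; rewrite ?mul0r//; rewrite -E mem_outputs in oN.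
Qed.

Lemma mprob_sum1 x : \sum_(o <- outputs) mprob x o = 1.
Proof.
rewrite (mprob_sum x xpredT) (eq_bigr (fun t => tw p t)) ?sum_tw ?p1 ?expr1n// => t _.
by under eq_bigr do rewrite mul1r; rewrite sum_sel mulr1.
Qed.

Definition mechanism : algorithm (X * bool)%type R (hypothesis X) n m :=
  Algorithm mprob_ge0 mprob_supp mprob_sum1 (fun o => proj1 (bmf_mprob o)).

Lemma score_neighbors h h' x x' : user_neighbors x x' ->
  score h h' x <= score h h' x' + 2 * B.
Proof.
move=> [i xx']; rewrite /score !big_tuple (bigD1 i)//= [X in _ <= X + _](bigD1 i)//=.
rewrite (eq_bigr (fun j => clip B (gap R h h' (tnth x' j)))); last first.
  by move=> j ji; rewrite xx'.
have := clip_bounded (gap R h h' (tnth x i)) B0.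
have := clip_bounded (gap R h h' (tnth x' i)) B0.
by rewrite !ler_norml => /andP[? ?] /andP[? ?]; lra.
Qed.

Lemma user_neighbors_sym x x' : user_neighbors x x' -> user_neighbors x' x.
Proof. by move=> [i xx']; exists i => j /xx'. Qed.

Lemma soft_neighbors t x x' l : user_neighbors x x' ->
  soft t x l <= expR (2 * g * B) * soft t x' l.
Proof.
move=> xx'; rewrite /soft mulr_sumr; apply: ler_sum => l' _.
rewrite -expRD ler_expR.
have := ler_wpM2l g0 (score_neighbors (H (tnth t l)) (H (tnth t l')) xx').
by lra.
Qed.

Lemma soft_inv_neighbors t x x' l : user_neighbors x x' ->
  (soft t x l)^-1 <= expR (2 * g * B) * (soft t x' l)^-1.
Proof.
move=> xx'; have := soft_neighbors t l (user_neighbors_sym xx').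
have s0 := soft_gt0 t x l; have s0' := soft_gt0 t x' l => ss.
by rewrite ler_pdivlMr// mulrC ler_pdivrMr.
Qed.

(** The weight and the normalizer each change by a factor at most [exp(2 g B)]. *)
Lemma sel_neighbors t x x' l : user_neighbors x x' ->
  sel t x l <= expR (4 * g * B) * sel t x' l.
Proof.
move=> xx'; rewrite /sel.
have S0 := sum_soft_gt0 t x; have S0' := sum_soft_gt0 t x'.
have SS : \sum_(l' < M) (soft t x' l')^-1 <= expR (2 * g * B) * \sum_(l' < M) (soft t x l')^-1.
  by rewrite mulr_sumr; apply: ler_sum => l' _; apply: soft_inv_neighbors; exact: user_neighbors_sym.
have ss := soft_inv_neighbors t l xx'.
have a0 : 0 < (soft t x' l)^-1 by rewrite invr_gt0 soft_gt0.
rewrite ler_pdivrMr// (_ : expR (4 * g * B) = expR (2 * g * B) * expR (2 * g * B)); last first.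
  by rewrite -expRD; congr expR; ring.
apply: (le_trans ss); set k := expR _; set a := (soft t x' l)^-1.
have k0 : 0 < k by exact: expR_gt0.
rewrite (_ : k * k * _ * _ = k * a * (k * (\sum_(l' < M) (soft t x l')^-1) / \sum_(l' < M) (soft t x' l')^-1)).
  by rewrite -[leLHS]mulr1 ler_pM2l ?mulr_gt0// ler_pdivlMr// mul1r.
by field; rewrite gt_eqF.
Qed.

Lemma mechanism_DP eps : 4 * g * B <= eps -> user_level_DP eps 0 mechanism.
Proof.
move=> ge x x' S xx'; rewrite addr0 /alg_in mulr_sumr; apply: ler_sum => o _ /=.
rewrite /mprob mulr_sumr; apply: ler_sum => t _; rewrite mulrCA; apply: ler_wpM2l; first exact: tw_ge0.
rewrite mulr_sumr; apply: ler_sum => l _; rewrite [leRHS]mulrCA; apply: ler_wpM2l => //.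
apply: (le_trans (sel_neighbors t l xx')); apply: ler_wpM2r; first exact: sel_ge0.
by rewrite ler_expR.
Qed.

(** The normalizer is at least the weight of [l0], and [soft t x l] is at least its single term
    against [l0]. What remains is a product over users, whose expectation factors. *)
Lemma sel_comparison t x l l0 : sel t x l <= \sum_(l' < M)
  \prod_(z <- x) expR (g * (clip B (gap R (H (tnth t l0)) (H (tnth t l')) z)
                            - clip B (gap R (H (tnth t l)) (H (tnth t l0)) z))).
Proof.
apply: (@le_trans _ _ (soft t x l0 / soft t x l)).
  rewrite /sel mulrC ler_pM2r ?invr_gt0 ?soft_gt0//.
  rewrite -[leRHS]invrK lef_pV2 ?posrE ?invr_gt0 ?soft_gt0 ?sum_soft_gt0//.
  exact: sum_soft_ge.
apply: (@le_trans _ _ (soft t x l0 / expR (g * score (H (tnth t l)) (H (tnth t l0)) x))).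
  rewrite ler_pM2l ?soft_gt0// lef_pV2 ?posrE ?soft_gt0 ?expR_gt0//.
  exact: soft_ge.
rewrite /soft mulr_suml le_eqVlt; apply/orP; left; apply/eqP; apply: eq_bigr => l' _.
by rewrite -expRN -expRD -mulrBr /score -sumrB mulr_sumr expR_sum.
Qed.

Variables (D : probability (X * bool)%type R) (alpha : R).
Hypotheses (m0 : (0 < m)%N) (a0 : 0 < alpha) (a1 : alpha <= 1)
  (BE : B = alpha / 2 + 6 * ln (128 / alpha) / Num.sqrt m%:R)
  (gB : g <= alpha / (32 * B ^+ 2)).

Lemma Ex_sel t l l0 : (forall l', err D (H (tnth t l0)) <= err D (H (tnth t l'))) ->
  err D (H (tnth t l0)) + alpha / 2 <= err D (H (tnth t l)) ->
  Ex (iid (iid D m) n) (fun x => sel t x l) <= M%:R * expR (- (g * alpha / 4)) ^+ n.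
Proof.
move=> l0min l0l.
pose F l' (z : m.-tuple (X * bool)) := expR (g * (clip B (gap R (H (tnth t l0)) (H (tnth t l')) z)
                            - clip B (gap R (H (tnth t l)) (H (tnth t l0)) z))).
have bF l' : bmf (F l').
  apply: bmf_expR; apply: bmfZ; apply: bmfB; apply: bmf_clip => //; exact: bmf_gap.
have bFp l' : bmf (fun x : data => \prod_(z <- x) F l' z) by exact: bmf_tuple_prod.
apply: (@le_trans _ _ (Ex (iid (iid D m) n) (fun x => \sum_(l' < M) \prod_(z <- x) F l' z))).
  apply: le_Ex; [exact: bmf_sel | exact: bmf_sum | move=> x; exact: sel_comparison].
rewrite Ex_sum// (le_trans (ler_sum _ (G := fun=> expR (- (g * alpha / 4)) ^+ n) _))//.
  move=> l' _; rewrite iid_Ex_prod//; apply: lerXn2r; rewrite ?nnegrE ?expR_ge0//.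
    by apply: Ex_ge_cst => // z; exact: expR_ge0.
  exact: comparison_mgf.
by rewrite sum_const_mul card_ord.
Qed.

(** Two failures cost [1/12] each: no good candidate is drawn, or a bad one is selected although a
    good one is present. The second is a union bound over [M] candidates, each contributing [M]
    comparison terms. *)
Lemma mechanism_accurate (v : R) (G : set (hypothesis X)) :
  (forall i, err D (H i) <= v + alpha -> G (H i)) ->
  (1 - \sum_(i | err D (H i) <= v + alpha / 2) p i) ^+ M <= 1 / 12 ->
  M%:R ^+ 2 * expR (- (g * alpha / 4)) ^+ n <= 1 / 12 ->
  2 / 3 <= Ex (iid (iid D m) n) (fun x => alg_in mechanism x G).
Proof.
move=> HG Hgood HM.
pose good i := err D (H i) <= v + alpha / 2.
pose S t x := \sum_(l < M) (H (tnth t l) \in G)%:R * sel t x l.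
have bS t : bmf (S t) by apply: bmf_sum => l; apply: bmfZ; exact: bmf_sel.
have -> : (fun x => alg_in mechanism x G) = (fun x => \sum_(t : M.-tuple I) tw p t * S t x).
  by apply/funext => x; rewrite /alg_in (mprob_sum x (fun o => o \in G)).
rewrite Ex_sum; last by move=> t; exact: bmfZ (bS t).
have S0 t : 0 <= Ex (iid (iid D m) n) (S t).
  by apply: (Ex_ge_cst _ (bS t)) => x; apply: sumr_ge0 => l _; rewrite mulr_ge0// sel_ge0.
have key t : has good t -> 11 / 12 <= Ex (iid (iid D m) n) (S t).
  move=> /(hasP)[i it gi].
  (* The reference is the best candidate drawn: it loses to no other in true error, and a wrong
     output exceeds it by at least [alpha/2]. *)
  have [l0 _ l0min] := arg_minP (fun l => err D (H (tnth t l))) (i0 := Ordinal M0) (P := xpredT) isT.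
  have l0good : err D (H (tnth t l0)) <= v + alpha / 2.
    by have /tnthP[l il] := it; apply: le_trans (l0min l _) _ => //; rewrite -il.
  have SE x : S t x = 1 - \sum_(l < M) (H (tnth t l) \notin G)%:R * sel t x l.
    rewrite -[X in _ = X - _](sum_sel t x) -sumrB; apply: eq_bigr => l _.
    by case: (_ \in G); rewrite /= ?mul1r ?mul0r ?subr0 ?subrr.
  have bN l : bmf (fun x => (H (tnth t l) \notin G)%:R * sel t x l) by apply: bmfZ; exact: bmf_sel.
  rewrite (_ : S t = fun x => 1 - \sum_(l < M) (H (tnth t l) \notin G)%:R * sel t x l); last exact/funext.
  rewrite ExB; [|exact: bmf_cst|exact: bmf_sum].
  rewrite Ex_cst Ex_sum//.
  suff : \sum_(l < M) Ex (iid (iid D m) n) (fun x => (H (tnth t l) \notin G)%:R * sel t x l) <= 1 / 12 by lra.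
  apply: le_trans HM; rewrite expr2 -mulrA -[X in _ <= X%:R * _](card_ord M) -sum_const_mul.
  apply: ler_sum => l _; rewrite ExZ; last exact: bmf_sel.
  case: (boolP (H (tnth t l) \in G)) => [_|lN] /=.
    by rewrite mul0r mulr_ge0// exprn_ge0// expR_ge0.
  rewrite mul1r; apply: (Ex_sel (l0 := l0)); first by move=> l'; exact: l0min.
  have : ~ err D (H (tnth t l)) <= v + alpha by move=> /HG /mem_set; rewrite (negbTE lN).
  by move/negP; rewrite -ltNge; lra.
apply: (@le_trans _ _ (\sum_(t : M.-tuple I | has good t) tw p t * (11 / 12))).
  rewrite -mulr_suml.
  have := sum_tw p M; rewrite p1 expr1n (bigID (fun t : M.-tuple I => has good t))/=.
  by rewrite (prior_all_miss good M p0 p1) -/good; move: Hgood; rewrite -/good; lra.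
rewrite big_mkcond/=; apply: ler_sum => t _; rewrite (ExZ _ _ (bS t)).
case: ifPn => [gt|_]; last by apply: mulr_ge0; [exact: tw_ge0 | exact: S0].
by apply: ler_wpM2l; [exact: tw_ge0 | exact: key].
Qed.

End mechanism.

(** * Sample complexity *)

Section upper_bound.
Context (R : realType) (disp : measure_display) (X : measurableType disp).
Implicit Types (C : set (hypothesis X)) (D : probability (X * bool)%type R).

Lemma err_triangle D (DX : probability X R) c h :
  (forall f, bmf f -> Ex DX f = Ex D (fun z => f z.1)) ->
  err D h <= err D c + dis DX c h.
Proof.
move=> HD; rewrite /dis HD; last exact: bmf_differ.
have b1 : bmf (fun z : X * bool => differ R c h z.1).
  by apply: (bmf_comp (phi := fst)); [exact: measurable_fst | exact: bmf_differ].
rewrite -ExD//; last exact: bmf_miss.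
apply: le_Ex; [exact: bmf_miss | by apply: bmfD => //; exact: bmf_miss |].
by move=> z; rewrite /miss /differ; case: (c z.1); case: (h z.1); case: z.2; rewrite /=; lra.
Qed.

(** The infimum over an infinite class need not be attained, so concepts arbitrarily close to it are
    provided. *)
Lemma inf_err C D : C !=set0 ->
  exists2 v : R, ereal_inf [set Err D c | c in C] = v%:E &
    forall e, 0 < e -> exists2 c, C c & err D c <= v + e.
Proof.
move=> [c0 Cc0].
have fin : ereal_inf [set Err D c | c in C] \is a fin_num.
  rewrite ge0_fin_numE.
    apply: (@le_lt_trans _ _ (Err D c0)); first by apply: ereal_inf_lbound; exists c0.
    by rewrite Err_err ltry.
  by apply: le_ereal_inf_tmp => _ [c _ <-]; rewrite Err_err lee_fin err_ge0.
exists (fine (ereal_inf [set Err D c | c in C])); first by rewrite fineK.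
move=> e e0; have [_ [c Cc <-]] := lb_ereal_inf_adherent e0 fin.
by rewrite Err_err -[in X in X -> _](fineK fin) -EFinD lte_fin => /ltW; exists c.
Qed.

Lemma mechanism_solves C (alpha gamma B g : R) (I : finType) (p : I -> R)
    (h : I -> hypothesis X) (M n m k : nat) :
  C !=set0 -> prior C (1 / 4) gamma p h -> 0 <= gamma <= 1 ->
  (0 < m)%N -> 0 < alpha <= 1 -> 0 <= g ->
  B = alpha / 2 + 6 * ln (128 / alpha) / Num.sqrt m%:R ->
  g <= alpha / (32 * B ^+ 2) ->
  (3 / 4) ^+ k <= alpha / 4 -> (0 < M)%N ->
  (1 - gamma ^+ (2 * k)) ^+ M <= 1 / 12 ->
  M%:R ^+ 2 * expR (- (g * alpha / 4)) ^+ n <= 1 / 12 ->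
  forall eps, 4 * g * B <= eps ->
  exists A : algorithm (X * bool)%type R (hypothesis X) n m,
    user_level_DP eps 0 A /\ solves (agn C alpha) A.
Proof.
move=> C0 pr /andP[gm0 gm1] m0 /andP[a0 a1] g0 BE gB ka M0 HM1 HM2 eps geps.
have [q0 q1 Hq] := boosted_prior k pr gm0.
have B0 : 0 <= B by have := B_ge a0 BE a1; lra.
exists (@mechanism R disp X _ _ (fun t : (2 * k).-tuple I => majority R (map h t)) M n m B g q0 q1 M0 B0); split.
  exact: mechanism_DP.
move=> D _; rewrite EFin_Ex; last exact: bmf_alg_in.
rewrite lee_fin.
have [v vE Hv] := inf_err D C0.
(* The error budget: [alpha/4] for a nearly optimal concept, [alpha/4] for its boosted approximation
   and [alpha/2] for the selection. *)
have a4 : 0 < alpha / 4 by lra.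
have [c Cc cv] := Hv _ a4.
have [DX HDX] := pushforward_law D (@measurable_fst _ _ X bool).
apply: (@mechanism_accurate _ _ _ _ _ _ _ _ _ _ _ q0 q1 M0 B0 g0 D alpha m0 a0 a1 BE gB v) => //.
  by move=> t et; rewrite /= vE Err_err -EFinD lee_fin.
apply: le_trans HM1; apply: lerXn2r.
- by rewrite nnegrE subr_ge0; exact: pmf_event_le1.
- by rewrite nnegrE subr_ge0 exprn_ile1.
rewrite lerD2l lerN2; apply: (le_trans (Hq c DX Cc)).
rewrite [leLHS]big_mkcond [leRHS]big_mkcond/=; apply: ler_sum => t _.
case: ifPn => [dt|_]; last by case: ifP.
rewrite ifT//; have := err_triangle c (majority R (map h t)) HDX.
by lra.
Qed.

(** Choice of the parameters. The bound [1/6 <= d] lets additive constants be absorbed into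
    multiples of [d]. *)
Lemma upper_bound_exists C (d alpha eps : R) (m : nat) :
  C !=set0 -> PRDim R C = d%:E -> 1 / 6 <= d -> 0 < alpha <= 1 / 64 -> 0 < eps <= 1 / 2 ->
  (0 < m)%N ->
  exists2 n : nat, exists A : algorithm (X * bool)%type R (hypothesis X) n m,
      user_level_DP eps 0 A /\ solves (agn C alpha) A &
    n%:R <= 1024 * 2560 * ln (128 / alpha) ^+ 3 *
      (d / eps + d / (alpha * eps * Num.sqrt m%:R) + d / (alpha ^+ 2 * m%:R)).
Proof.
move=> C0 Cd d6 /andP[a0 a1] /andP[e0 e1] m0.
have [I [p [h pr]]] := PRDim_prior Cd.
set b := ln (128 / alpha); set r := Num.sqrt m%:R.
have mp : 0 < m%:R :> R by rewrite ltr0n.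
have rp : 0 < r by rewrite sqrtr_gt0.
have rr : r ^+ 2 = m%:R by rewrite sqr_sqrtr// ltW.
have b1 : 1 <= b.
  rewrite -(expRK (1 : R)); apply: ln_pos_le; first exact: expR_gt0.
  apply: (le_trans (expR1_le4 R)); rewrite ler_pdivlMr//; lra.
(* Since [(3/4)^k <= exp(-k/4)], this many rounds bring the boosted error below [alpha/4]. *)
pose y : R := 4 * ln (4 / alpha).
have y0 : 0 <= y by rewrite mulr_ge0// ln_ge0// ler_pdivlMr//; lra.
have [k _ /andP[yk ky]] := nat_ceil y0.
have kb : k%:R <= 5 * b.
  have : ln (4 / alpha) <= b.
    apply: ln_pos_le; first by rewrite divr_gt0.
    by rewrite ler_pM2r ?invr_gt0//; lra.
  by move: ky; rewrite /y; lra.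
have ka : (3 / 4) ^+ k <= alpha / 4.
  apply: (@le_trans _ _ (expR (- (1 / 4) * k%:R))).
    have := @exprn_le_expR R (- (1 / 4)) k; rewrite (_ : 1 - 1 / 4 = 3 / 4); last by field.
    by apply; lra.
  rewrite -[leRHS]lnK ?posrE ?divr_gt0// ler_expR -[alpha / 4]invf_div lnV ?posrE ?divr_gt0//.
  by move: yk; rewrite /y; lra.
pose gamma : R := 6 / 10 * expR (- d).
have gm0 : 0 < gamma by rewrite mulr_gt0 ?expR_gt0//; lra.
have gm1 : gamma <= 1.
  have : expR (- d) <= 1 by rewrite -[leRHS]expR0 ler_expR; lra.
  by rewrite /gamma; lra.
have gmE : expR (- (d + 1)) <= gamma.
  rewrite opprD expRD mulrC /gamma ler_pM2r ?expR_gt0//.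
  rewrite expRN -[leRHS]invrK lef_pV2 ?posrE ?invr_gt0 ?expR_gt0//.
  by have := expR_ge1Dx (1 : R); lra.
(* An upper bound for [ln M]: [M <= 5 / gamma^(2k)], with [5 <= exp(2)] and
   [gamma >= exp(-(d + 1))]. *)
pose L : R := 2 + (2 * k)%:R * (d + 1).
pose G := gamma ^+ (2 * k).
have G0 : 0 < G by exact: exprn_gt0.
have G1 : G <= 1 by rewrite exprn_ile1// ltW.
have z0 : 0 <= 4 / G by rewrite divr_ge0// ltW.
have [M M0 /andP[M2 M1]] := nat_ceil z0.
have MG : M%:R <= 5 / G.
  have : 1 <= 1 / G by rewrite ler_pdivlMr// mul1r.
  by move: M1; lra.
have ML : M%:R <= expR L.
  apply: (le_trans MG); rewrite /L expRD; apply: ler_pM => //.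
  - by rewrite invr_ge0 ltW.
  - exact: expR2_ge5.
  rewrite mulrC expRM_natr /G -exprVn; apply: lerXn2r; rewrite ?nnegrE ?expR_ge0 ?invr_ge0 ?(ltW gm0)//.
  by rewrite -[leRHS]invrK lef_pV2 ?posrE ?invr_gt0 ?expR_gt0// -expRN.
have HM1 : (1 - G) ^+ M <= 1 / 12.
  apply: (@le_trans _ _ (expR (- G * M%:R))); first by apply: exprn_le_expR; lra.
  apply: le_trans (expRN4_le R); rewrite ler_expR mulNr lerN2.
  by move: M2; rewrite ler_pdivrMr// mulrC.
have [B BE] : {B : R | B = alpha / 2 + 6 * b / r} by eexists.
have Bp : 0 < B by rewrite BE addr_gt0 ?divr_gt0 ?mulr_gt0//; lra.
pose g1 := eps / (4 * B); pose g2 := alpha / (32 * B ^+ 2).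
have g1p : 0 < g1 by rewrite divr_gt0// mulr_gt0.
have g2p : 0 < g2 by rewrite divr_gt0// mulr_gt0// exprn_gt0.
(* Here [g1] is the largest rate that privacy allows and [g2] the largest for which the comparison
   moment bound holds. *)
pose g := Num.min g1 g2.
have gp : 0 < g by rewrite lt_min g1p.
have gV : g^-1 <= g1^-1 + g2^-1.
  rewrite /g; case: (leP g1 g2) => _; rewrite ?lerDl ?lerDr invr_ge0; exact: ltW.
(* From [n >= q] it follows that [g * alpha * n / 4 >= 2 * L + 4], which beats [M^2 <= exp(2 L)] and
   leaves [exp(-4) <= 1/12]. *)
pose q := (8 * L + 16) / (g * alpha).
have L0 : 0 <= L by rewrite /L addr_ge0// mulr_ge0//; lra.
have q0 : 0 <= q by rewrite divr_ge0 ?mulr_ge0 ?(ltW gp) ?(ltW a0)//; lra.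
have [n _ /andP[n2 n1]] := nat_ceil q0.
exists n.
  apply: (@mechanism_solves C alpha gamma B g I p h M n m k) => //.
  - by rewrite (ltW gm0).
  - by rewrite a0; lra.
  - exact: ltW.
  - by rewrite /g ge_min lexx orbT.
  - rewrite -expRM_natr; apply: (@le_trans _ _ (expR (L + L) * expR (- (g * alpha / 4) * n%:R))).
      apply: ler_wpM2r; first exact: expR_ge0.
      by rewrite expRD expr2; apply: ler_pM.
    rewrite -expRD; apply: le_trans (expRN4_le R); rewrite ler_expR.
    by move: n2; rewrite ler_pdivrMr ?mulr_gt0//; lra.
  - have : g <= g1 by rewrite /g ge_min lexx.
    by rewrite /g1 ler_pdivlMr ?mulr_gt0//; lra.
pose T := eps^-1 + (alpha * eps * r)^-1 + (alpha ^+ 2 * m%:R)^-1.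
have T1 : 0 < eps^-1 by rewrite invr_gt0.
have T2 : 0 < (alpha * eps * r)^-1 by rewrite invr_gt0 !mulr_gt0.
have T3 : 0 < (alpha ^+ 2 * m%:R)^-1 by rewrite invr_gt0 mulr_gt0// exprn_gt0.
have T4 : 2 <= eps^-1 by rewrite -[leLHS]invrK lef_pV2 ?posrE// ?invr_gt0//; lra.
have b2 : 1 <= b ^+ 2 by rewrite exprn_ege1.
have LT : 8 * L + 16 <= 1024 * b * d.
  have kd : (2 * k)%:R * (d + 1) <= 10 * b * (7 * d).
    rewrite natrM; apply: ler_pM; rewrite ?mulr_ge0//; lra.
  have bd : 1 / 6 <= b * d by nra.
  by rewrite /L; lra.
(* The rate [g1] produces the two terms with [eps]; [g2] produces the term in [alpha^2 m] and a
   constant, absorbed by [eps^-1 >= 2]. *)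
have gT : (g * alpha)^-1 <= 2304 * b ^+ 2 * T.
  apply: (@le_trans _ _ ((g1^-1 + g2^-1) / alpha)).
    by rewrite invfM ler_pM2r// invr_gt0.
  have -> : (g1^-1 + g2^-1) / alpha = 4 * (B / alpha) * eps^-1 + 32 * (B / alpha) ^+ 2.
    by rewrite /g1 /g2 !invf_div; field; rewrite !gt_eqF.
  have -> : B / alpha = 1 / 2 + 6 * b / (alpha * r) by rewrite BE; field; rewrite !gt_eqF.
  have -> : 4 * (1 / 2 + 6 * b / (alpha * r)) * eps^-1 =
      2 * eps^-1 + 24 * b * (alpha * eps * r)^-1 by field; rewrite !gt_eqF.
  have sq : (1 / 2 + 6 * b / (alpha * r)) ^+ 2 <= 1 / 2 + 72 * b ^+ 2 * (alpha ^+ 2 * m%:R)^-1.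
    rewrite -rr -subr_ge0.
    rewrite (_ : _ - _ = (1 / 2 - 6 * b / (alpha * r)) ^+ 2); first exact: sqr_ge0.
    by field; rewrite !gt_eqF.
  have bT2 : b * (alpha * eps * r)^-1 <= b ^+ 2 * (alpha * eps * r)^-1.
    by rewrite ler_pM2r// expr2 ler_peMr//; lra.
  have bT1 : eps^-1 <= b ^+ 2 * eps^-1 by rewrite ler_peMl// ltW.
  have bT2' : 0 <= b ^+ 2 * (alpha * eps * r)^-1 by rewrite mulr_ge0 ?ltW// exprn_gt0//; lra.
  by rewrite /T; move: bT1 bT2 bT2' sq T4; lra.
have qT : q <= 1024 * b * d * (2304 * b ^+ 2 * T).
  by rewrite /q; apply: ler_pM => //; [lra | rewrite invr_ge0 mulr_ge0// ltW].
have dT : 1 / 3 <= d * T by rewrite /T; nra.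
have b3 : 1 <= b ^+ 3 by rewrite exprn_ege1.
have bT : 1 / 3 <= b ^+ 3 * (d * T) by nra.
rewrite [leRHS](_ : _ = 1024 * 2560 * (b ^+ 3 * (d * T))); last by rewrite /T; ring.
apply: (@le_trans _ _ (1024 * 2304 * (b ^+ 3 * (d * T)) + 1)); last lra.
apply: (le_trans n1); rewrite lerD2r; apply: (le_trans qT).
by rewrite le_eqVlt; apply/orP; left; apply/eqP; ring.
Qed.

End upper_bound.

Section single_concept.
Context (R : realType) (disp : measure_display) (X : measurableType disp).
Implicit Types (C : set (hypothesis X)) (c : hypothesis X).

Let cprob n m c (x : dataset (X * bool)%type n m) (o : hypothesis X) : R := (o == c)%:R.

Lemma cprob_supp n m c x o : o \notin [fset c]%fset -> @cprob n m c x o = 0.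
Proof. by rewrite /cprob inE => /negbTE ->. Qed.

Lemma cprob_sum1 n m c x : \sum_(o <- [fset c]%fset) @cprob n m c x o = 1.
Proof. by rewrite big_seq_fset1 /cprob eqxx. Qed.

(** A class with a single concept is learned without data; it escapes the general construction,
    which assumes [1/6 <= d]. *)
Definition constant_algorithm n m c : algorithm (X * bool)%type R (hypothesis X) n m :=
  Algorithm (fun x o => ler0n R _) (@cprob_supp n m c) (@cprob_sum1 n m c)
    (fun o => @measurable_cst _ _ _ _ _ _).

Lemma constant_solves C (alpha eps : R) n m c : C c -> (forall c', C c' -> c' = c) ->
  0 <= alpha -> 0 <= eps ->
  user_level_DP eps 0 (constant_algorithm n m c) /\
  solves (agn C alpha) (constant_algorithm n m c).
Proof.
move=> Cc Cc' a0 e0; split.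
  move=> x x' S _; rewrite addr0 /alg_in /= -[leLHS]mul1r; apply: ler_wpM2r.
    by apply: sumr_ge0 => o _.
  by rewrite -[leLHS]expR0 ler_expR.
move=> D _; rewrite EFin_Ex; last exact: bmf_alg_in.
rewrite lee_fin; apply: Ex_ge_cst; first exact: bmf_alg_in.
move=> x; rewrite /alg_in /= big_mkcond big_seq_fset1 mem_set /=.
  by rewrite /cprob eqxx /=; lra.
apply: (@le_trans _ _ (ereal_inf [set Err D c' | c' in C])).
  by apply: le_ereal_inf_tmp => _ [c' /Cc' -> <-].
by rewrite leeDl// lee_fin.
Qed.

End single_concept.

(** * Assembling the upper and lower bounds *)

Section complexity.
Context (R : realType) (disp : measure_display) (X : measurableType disp).
Context (C : set (hypothesis X)) (d : R) (dVC : nat) (alpha eps : R) (m : nat).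
Hypotheses (Cd : PRDim R C = d%:E) (CVC : VCdim R C = dVC%:R%:E)
  (a0 : 0 < alpha) (a1 : alpha <= 1 / 64) (e0 : 0 < eps) (e1 : eps <= 1 / 2) (m0 : (0 < m)%N).

Let C0 : C !=set0.
Proof. by have [S shS _] := VCdim_attained CVC; have [c Cc _] := shS set0; exists c. Qed.

(** Under the point mass at [x], approximating [c] and approximating [c'] are disjoint events of
    prior mass at least [6/10 * expR (- d)] each. *)
Lemma two_concepts_PRDim c c' x : C c -> C c' -> c x != c' x -> 1 / 6 <= d.
Proof.
move=> Cc Cc' cc'; have [I [p [h [p0 p1 Hp]]]] := PRDim_prior Cd.
pose D : probability X R := dirac x.
have disx c1 i : dis D c1 (h i) <= 1 / 4 -> h i x = c1 x.
  rewrite /dis /Ex /Rintegral integral_dirac//; last first.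
    by apply/measurable_EFinP; case: (bmf_differ R c1 (h i)).
  rewrite diracT mul1e /= /differ; case: eqP => [->//|_] /=; lra.
have H1 := Hp c D Cc; have H2 := Hp c' D Cc'.
have : \sum_(i | dis D c (h i) <= 1 / 4) p i +
       \sum_(i | dis D c' (h i) <= 1 / 4) p i <= 1.
  rewrite -[leRHS]p1 [X in X + _]big_mkcond [X in _ + X]big_mkcond -big_split/=.
  apply: ler_sum => i _; case: ifPn => [/disx e2|_]; case: ifPn => [/disx e3|_]; rewrite ?addr0 ?add0r//.
  by move: cc'; rewrite -e2 -e3 eqxx.
move=> H3; have H4 : 12 / 10 * expR (- d) <= 1 by lra.
have H5 : expR (- d) <= 10 / 12 by lra.
by have := expR_ge1Dx (- d); lra.
Qed.

Lemma complexity_upper :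
  (user_complexity (agn C alpha) m eps 0 <= (1024 * 2560 * ln (128 / alpha) ^+ 3 *
     (d / eps + d / (alpha * eps * Num.sqrt m%:R) + d / (alpha ^+ 2 * m%:R)))%:E)%E.
Proof.
have [[c [c' [x [Cc Cc' cc']]]]|noc] := pselect (exists c c' x, [/\ C c, C c' & c x != c' x]).
  have d6 := two_concepts_PRDim Cc Cc' cc'.
  have [||n HA Hn] := upper_bound_exists (alpha := alpha) (eps := eps) C0 Cd d6 _ _ m0.
  - by rewrite a0 a1.
  - by rewrite e0 e1.
  apply: (@le_trans _ _ (n%:R)%:E); last by rewrite lee_fin.
  by apply: ereal_inf_lbound; exists n.
have [c Cc] := C0.
apply: (@le_trans _ _ (0%:R)%:E).
  apply: ereal_inf_lbound; exists 0%N => //=; exists (constant_algorithm R 0 m c).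
  apply: constant_solves => //; [|exact: ltW|exact: ltW].
  move=> c' Cc'; apply/mfuneqP => x; apply/eqP; apply: contrapT => /negP cc'.
  by apply: noc; exists c', c, x.
have d0 := PRDim_ge0 Cd.
have ln0 : 0 <= ln (128 / alpha).
  by rewrite ln_ge0// ler_pdivlMr//; have := a1; lra.
rewrite lee_fin; apply: mulr_ge0.
  apply: mulr_ge0; last exact: exprn_ge0.
  by apply: mulr_ge0; exact: ler0n.
by rewrite !addr_ge0// divr_ge0// ?mulr_ge0 ?exprn_ge0 ?sqrtr_ge0// ltW.
Qed.

Lemma complexity_lower n (A : algorithm (X * bool)%type R (hypothesis X) n m) :
  user_level_DP eps 0 A -> solves (agn C alpha) A ->
  d / eps + dVC%:R / (alpha * eps * Num.sqrt m%:R) + dVC%:R / (alpha ^+ 2 * m%:R)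
    <= 1024 * 256 * n%:R.
Proof.
move=> dpA solA; have [S shS Sk] := VCdim_attained CVC.
have n0 : 0 <= n%:R :> R by [].
have ap := a0; have ap1 := a1; have ep := e0; have ep1 := e1.
have mp : 0 < m%:R :> R by rewrite ltr0n.
have rp : 0 < Num.sqrt m%:R :> R by rewrite sqrtr_gt0.
have B2 : dVC%:R / (alpha * eps * Num.sqrt m%:R) <= 1280 * n%:R.
  rewrite ler_pdivrMr ?mulr_gt0//; have [->|k0] := posnP dVC.
    by apply: mulr_ge0; [apply: mulr_ge0; [exact: ler0n | exact: n0] | apply: ltW; rewrite !mulr_gt0].
  have := vc_lower_private shS Sk k0 ap ap1 ep m0 dpA solA ep1; lra.
have B3 : dVC%:R / (alpha ^+ 2 * m%:R) <= 1024 * 201 * n%:R.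
  rewrite ler_pdivrMr ?mulr_gt0 ?exprn_gt0//; have [->|k0] := posnP dVC.
    apply: mulr_ge0; last by apply: ltW; rewrite mulr_gt0// exprn_gt0.
    by apply: mulr_ge0; [apply: mulr_ge0; exact: ler0n | exact: n0].
  have := vc_lower_sample shS Sk k0 ap ap1 solA; lra.
(* A positive [d] forces two distinct concepts, hence positive VC dimension and [eps * n >= 1/10].
   This turns [d <= eps * n + 2] into [d <= 21 * eps * n]. *)
have B1 : d / eps <= 21 * n%:R.
  rewrite ler_pdivrMr//; have [dp|dn] := ltP 0 d; last first.
    by rewrite (le_trans dn)// mulr_ge0 ?mulr_ge0// ltW.
  have [c [c' [x [Cc Cc' cc']]]] := PRDim_gt0_two_concepts Cd dp.
  have k0 := two_concepts_VC CVC Cc Cc' cc'.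
  have := vc_lower_user shS Sk k0 ap ap1 dpA solA.
  have k1 : 1 <= dVC%:R :> R by rewrite ler1n.
  have a4 : alpha <= 1 / 4 by lra.
  by have := PRDim_lower Cd a4 dpA solA (ltW ep); lra.
by lra.
Qed.

End complexity.

(** The hidden polylogarithmic factor is a fixed power of one logarithm, and all constants are
    chosen before the domain and the class. *)
Theorem theoremE4 (R : realType) :
  exists (alpha0 eps0 K : R) (p : nat),
    [/\ 0 < alpha0, 0 < eps0, 0 < K &
    forall (disp : measure_display) (X : measurableType disp)
      (C : set (hypothesis X)) (d : R) (dVC : nat),
      PRDim R C = d%:E ->
      VCdim R C = dVC%:R%:E ->
      forall (alpha eps : R) (m : nat),
      0 < alpha <= alpha0 -> 0 < eps <= eps0 -> (0 < m)%N ->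
      let L := ln (3 + d + alpha^-1 + eps^-1) ^+ p in
      let n := user_complexity (agn C alpha) m eps 0 in
      (n <= (K * L * (d / eps
                      + d / (alpha * eps * Num.sqrt m%:R)
                      + d / (alpha ^+ 2 * m%:R)))%:E)%E
      /\
      ((K^-1 * L^-1 * (d / eps
                       + dVC%:R / (alpha * eps * Num.sqrt m%:R)
                       + dVC%:R / (alpha ^+ 2 * m%:R)))%:E <= n)%E].
Proof.
have [K [K0 KU KL]] : exists K : R, [/\ 0 < K, 1024 * 2560 * 27 <= K & 1024 * 256 <= K].
  by exists (1024 * 2560 * 27); split; lra.
exists (1 / 64), (1 / 2), K, 3%N; split; [lra | lra | exact: K0 |].
move=> disp X C d dVC Cd CVC alpha eps m /andP[a0 a1] /andP[e0 e1] m0.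
have d0 := PRDim_ge0 Cd.
set l := ln (3 + d + alpha^-1 + eps^-1).
have aV : 64 <= alpha^-1 by rewrite -[leLHS]invrK lef_pV2 ?posrE ?invr_gt0//; lra.
have eV : 0 < eps^-1 by rewrite invr_gt0.
have la : ln (alpha^-1) <= l by apply: ln_pos_le; lra.
have l1 : 1 <= l.
  apply: le_trans la; rewrite -(expRK (1 : R)); apply: ln_pos_le; first exact: expR_gt0.
  by apply: (le_trans (expR1_le4 R)); lra.
(* As [alpha^-1 >= 64], [128 / alpha] is at most [alpha^-3]. The cube of the resulting 3 is the
   factor 27 in [K]. *)
have lb : ln (128 / alpha) <= 3 * l.
  apply: (@le_trans _ _ (ln (alpha^-1 ^+ 3))).
    apply: ln_pos_le; first by rewrite divr_gt0.
    have : 128 <= alpha^-1 ^+ 2 by nra.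
    by move=> a2; rewrite (exprSr _ 2); apply: ler_wpM2r; [lra | exact: a2].
  by rewrite lnXn ?invr_gt0// -(mulr_natl (ln _) 3); lra.
have lb0 : 0 <= ln (128 / alpha) by rewrite ln_ge0// ler_pdivlMr//; lra.
have l3 : 1 <= l ^+ 3 by rewrite exprn_ege1.
split.
  apply: (le_trans (complexity_upper Cd CVC a0 a1 e0 e1 m0)); rewrite lee_fin.
  apply: ler_wpM2r.
    by rewrite !addr_ge0// divr_ge0// ?mulr_ge0 ?exprn_ge0 ?sqrtr_ge0// ltW.
  have lb3 : ln (128 / alpha) ^+ 3 <= 27 * l ^+ 3.
    rewrite (_ : 27 * l ^+ 3 = (3 * l) ^+ 3); last by ring.
    by apply: lerXn2r; rewrite ?nnegrE//; lra.
  apply: (@le_trans _ _ (1024 * 2560 * (27 * l ^+ 3))).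
    by apply: ler_wpM2l; [apply: mulr_ge0; exact: ler0n | exact: lb3].
  by rewrite mulrA; apply: ler_wpM2r; [lra | exact: KU].
apply: le_ereal_inf_tmp => _ [n [A [dpA solA]] <-]; rewrite lee_fin.
have low := complexity_lower Cd CVC a0 a1 e0 e1 m0 dpA solA.
have Kl : 0 < K * l ^+ 3 by apply: mulr_gt0; [exact: K0 | lra].
rewrite -invfM ler_pdivrMl; last exact: Kl.
apply: (le_trans low); apply: ler_wpM2r; first exact: ler0n.
apply: (le_trans KL); rewrite ler_peMr; [by [] | exact: ltW | exact: l3].
Qed.
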